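(* In the setting of the context (in particular with continuous $c$, weakly continuous $p$, the Lipschitz bounds with constants $\tilde L_1,\tilde K_1$, and $\beta\tilde K_1<1$), for each $T\ge1$ let $(\tilde\pi^T_t,\tilde\mu^T_t)_{t\ge0}$ be an extended mean-field equilibrium of the $T$-horizon game $(X,A,c,p,\mu_0,T)$. Then any accumulation point, as $T\to\infty$, of the family $\{(\tilde\pi^T_t\otimes\tilde\mu^T_t)_{t\ge0}:T\ge1\}$ in $\mathcal P(X\times A)^\infty=\prod_{t=0}^\infty\mathcal P(X\times A)$, under the product topology generated by weak convergence of probability measures, yields after disintegration a mean-field equilibrium of the infinite-horizon non-stationary game $(X,A,c,p,\mu_0)$: that is, if the accumulation point is written as $(\pi_t\otimes\mu_t)_{t\ge0}$, with $\mu_t$ the $X$-marginal and $\pi_t$ a conditional kernel, then $((\pi_t)_{t\ge0},(\mu_t)_{t\ge0})$ is such an equilibrium.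
   Context: $(X,d_X)$ is a compact metric space, $A$ a compact convex subset of some $\mathbb R^m$, $\beta\in[0,1)$, $c:X\times A\times\mathcal P(X)\to\mathbb R$, $p:X\times A\times\mathcal P(X)\to\mathcal P(X)$, $\mu_0\in\mathcal P(X)$. $\mathcal P(X)$ carries the weak topology, metrized by the 1-Wasserstein metric $W_1$. Assumptions: (i) if $(x_n,a_n,\mu_n)\to(x,a,\mu)$ in $X\times A\times\mathcal P(X)$, then $c(x_n,a_n,\mu_n)\to c(x,a,\mu)$ and $p(\cdot|x_n,a_n,\mu_n)\to p(\cdot|x,a,\mu)$ weakly; (ii) for all $x,\hat x\in X$, $a\in A$, $\mu\in\mathcal P(X)$: $|c(x,a,\mu)-c(\hat x,a,\mu)|\le\tilde L_1d_X(x,\hat x)$ and $W_1(p(\cdot|x,a,\mu),p(\cdot|\hat x,a,\mu))\le\tilde K_1d_X(x,\hat x)$; (iii) $\beta\tilde K_1<1$. A policy is a stochastic kernel $\pi:X\to\mathcal P(A)$; $\pi\otimes\mu(da,dx):=\pi(da|x)\mu(dx)$. A mean-field equilibrium of the $T$-horizon game $(X,A,c,p,\mu_0,T)$ is a pair of flows $(\pi^T_t)_{t=0}^{T-1}$, $(\mu^T_t)_{t=0}^{T-1}$ with $\mu^T_0=\mu_0$ such that (1) $(\pi^T_t)_t$ minimizes $E[\sum_{t=0}^{T-1}\beta^tc(x_t,a_t,\mu^T_t)]$ over Markov policies, where $x_0\sim\mu_0$, $a_t\sim\pi_t(\cdot|x_t)$, $x_{t+1}\sim p(\cdot|x_t,a_t,\mu^T_t)$,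 and (2) $\mu^T_{t+1}(\cdot)=\int_X\int_A p(\cdot|x,a,\mu^T_t)\pi^T_t(da|x)\mu^T_t(dx)$. A mean-field equilibrium of the infinite-horizon non-stationary game $(X,A,c,p,\mu_0)$ is the analogous pair $((\pi_t)_{t\ge0},(\mu_t)_{t\ge0})$, $T$ being replaced by $\infty$ in the cost sum and in the flows. The extended mean-field equilibrium associated with a $T$-horizon equilibrium is $(\tilde\pi^T_t,\tilde\mu^T_t)=(\pi^T_t,\mu^T_t)$ for $t\le T-1$ and $(\tilde\pi^T_t,\tilde\mu^T_t)=(\pi^T_{T-1},\mu^T_{T-1})$ for $t\ge T$. *)

(* Defs.v *)
From HB Require Import structures.
From mathcomp Require Import all_boot all_order all_algebra.
From mathcomp Require Import all_classical all_reals all_analysis.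

Set Implicit Arguments.
Unset Strict Implicit.
Unset Printing Implicit Defensive.

Import Order.TTheory GRing.Theory Num.Theory.
Import numFieldNormedType.Exports.

Local Open Scope classical_set_scope.
Local Open Scope ring_scope.

(* A bare [measurableTopologicalType] imposes no compatibility between the two
   structures: it only serves to state the weak topology on products, whose
   canonical sigma-algebra is the product one.  For second countable Borel
   factors the latter is the Borel sigma-algebra of the product. *)
#[short(type="measurableTopologicalType")]
HB.structure Definition MeasurableTopological d :=
  {T of Topological T & Measurable d T}.

HB.mixin Record isBorel d T & Topological T & Measurable d T := {
  measurable_borel : (measurable : set (set T)) = <<s (open : set (set T)) >>
}.

#[short(type="borelType")]
HB.structure Definition Borel d :=
  {T of Topological T & Measurable d T & isBorel d T}.

#[short(type="borelMetricType")]
HB.structure Definition BorelMetric (R : numDomainType) d :=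
  {T of Metric R T & Measurable d T & isBorel d T}.

HB.instance Definition _ d1 d2 (T1 : measurableTopologicalType d1)
  (T2 : measurableTopologicalType d2) := Measurable.on (T1 * T2)%type.

(* Measurable types are pointed in the library, hence the proof of nonemptiness
   needed to equip the subspace A with its Borel sigma-algebra. *)
Definition borel_subspace (T : topologicalType) (A : set T) (A0 : A !=set0)
  : Type := set_type A.

Section borel_subspace.
Context (T : topologicalType) (A : set T) (A0 : A !=set0).

HB.instance Definition _ := Topological.copy (borel_subspace A0) (set_type A).

Let pt : borel_subspace A0 := exist _ (sval (cid A0)) (mem_set (svalP (cid A0))).

HB.instance Definition _ := isPointed.Build (borel_subspace A0) pt.

Definition borel_display : measure_display. Proof. by constructor. Qed.

Let B := <<s (open : set (set (borel_subspace A0))) >>.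

HB.instance Definition _ := @isMeasurable.Build borel_display (borel_subspace A0)
  B (@sigma_algebra0 _ setT _) (@sigma_algebraC _ _) (@sigma_algebra_bigcup _ setT _).

HB.instance Definition _ := @isBorel.Build borel_display (borel_subspace A0) erefl.

End borel_subspace.

Section weak_topology.
Context d (T : measurableTopologicalType d) (R : realType).

Definition wprobability : Type := probability T R.

Definition bounded_continuous :=
  {f : T -> R | continuous f /\ bounded_fun f}.

Definition weak_pairing (P : wprobability) : {ptws bounded_continuous -> R} :=
  fun f => \int[(P : probability T R)]_x sval f x.

HB.instance Definition _ := Choice.copy wprobability (probability T R).
HB.instance Definition _ :=
  Topological.copy wprobability (initial_topology weak_pairing).

End weak_topology.

Section wasserstein.
Local Open Scope ereal_scope.
Context d (R : realType) (X : borelMetricType R d).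

Definition coupling (mu nu : probability X R) : set (probability (X * X)%type R) :=
  [set g | forall B, measurable B ->
    g (fst @^-1` B) = mu B /\ g (snd @^-1` B) = nu B].

Definition wasserstein1 (mu nu : probability X R) : \bar R :=
  ereal_inf [set \int[g]_z (mdist z.1 z.2)%:E | g in coupling mu nu].

End wasserstein.

Section joint_law.
Local Open Scope ereal_scope.
Context d d' (X : measurableType d) (A : measurableType d') (R : realType).
Variables (pi : R.-pker X ~> A) (mu : probability X R).

(* pi (x) mu, with the state as first component. *)
Definition joint_law (B : set (X * A)) : \bar R :=
  \int[mu]_x pi x (xsection B x).

Let joint_law0 : joint_law set0 = 0.
Proof. by apply: integral0_eq => x _; rewrite xsection0 measure0. Qed.

Let joint_law_ge0 B : 0 <= joint_law B.
Proof. by apply: integral_ge0 => x _; exact: measure_ge0. Qed.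

Let joint_law_sigma_additive : semi_sigma_additive joint_law.
Proof.
move=> F mF tF mUF; rewrite [X in _ --> X](_ : _ =
    \sum_(0 <= n <oo) joint_law (F n)); last first.
  rewrite /joint_law -(@integral_nneseries _ _ R mu _ measurableT
    (fun n x => pi x (xsection (F n) x)))//=; last first.
    move=> n; apply: measurable_fun_xsection_finite_kernel.
    by rewrite inE.
  apply: eq_integral => x _; rewrite xsection_bigcup.
  apply/esym/cvg_lim => //; apply: measure_semi_sigma_additive.
  - by move=> n; exact: measurable_xsection.
  - exact: trivIset_xsection.
  - by apply: bigcup_measurable => n _; exact: measurable_xsection.
by apply: is_cvg_nneseries => n _ _; exact: joint_law_ge0.
Qed.

HB.instance Definition _ := isMeasure.Build _ _ _ joint_law
  joint_law0 joint_law_ge0 joint_law_sigma_additive.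

Let joint_law_setT : joint_law [set: X * A] = 1.
Proof.
rewrite /joint_law (eq_integral (cst 1))/=; last first.
  by move=> x _; rewrite xsectionE preimage_setT prob_kernel.
by rewrite integral_cst// mul1e; exact: probability_setT.
Qed.

HB.instance Definition _ :=
  Measure_isProbability.Build _ _ _ joint_law joint_law_setT.

End joint_law.

(* Horizon [Some T] means the stages t < T, and [None] all stages; flows are
   indexed by nat and their values outside of the horizon are never used. *)
Definition stage (h : option nat) (t : nat) : bool :=
  if h is Some T then (t < T)%N else true.

(* [total h u] is u_0 + ... + u_(T-1), or the sum of the series when h = None *)
Definition total (R : realType) (h : option nat) (u : nat -> R) : R :=
  if h is Some T then \sum_(t < T) u t else limn (series u).

Definition extended_flow (V : Type) (T : nat) (u : nat -> V) : nat -> V :=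
  fun t => if (t < T)%N then u t else u T.-1.

Definition joint_flow (R : realType) d d' (X : borelMetricType R d)
    (A : borelType d') (pi : nat -> R.-pker X ~> A)
    (mu : nat -> wprobability X R) : {ptws nat -> wprobability (X * A)%type R} :=
  fun t => joint_law (pi t) (mu t).

(* sigma(x_0, ..., x_(n-1), a_0, ..., a_(m-1)) *)
Definition history d0 d d' (O : measurableType d0) (X : measurableType d)
    (A : measurableType d') (x : nat -> O -> X) (a : nat -> O -> A)
    (n m : nat) : set (set O) :=
  <<s [set H | exists s B, [/\ (s < n)%N, measurable B & H = x s @^-1` B]] `|`
      [set H | exists s C, [/\ (s < m)%N, measurable C & H = a s @^-1` C]] >>.

Section mean_field_game.
Local Open Scope ereal_scope.
Context (R : realType) d d' (X : borelMetricType R d) (A : borelType d').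
Variables (beta : R) (c : X -> A -> wprobability X R -> R).
Variables (p : X -> A -> wprobability X R -> wprobability X R).
Variables (mu0 : probability X R) (h : option nat).

Implicit Types (pi : nat -> R.-pker X ~> A) (mu : nat -> wprobability X R).

(* x_0 ~ mu0, a_t ~ pi_t(.|x_t) and x_(t+1) ~ p(.|x_t, a_t, mu_t), the last two
   being conditional laws given the whole past. *)
Record controlled_process pi mu d0 (O : measurableType d0) (P : probability O R)
    (x : nat -> {RV P >-> X}) (a : nat -> {RV P >-> A}) : Prop := {
  initial_law : forall B, measurable B -> P (x 0%N @^-1` B) = mu0 B ;
  action_law : forall t, stage h t -> forall H C,
    history x a t.+1 t H -> measurable C ->
    P (H `&` a t @^-1` C) = \int[P]_(w in H) pi t (x t w) C ;
  transition_law : forall t, stage h t.+1 -> forall H B,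
    history x a t.+1 t.+1 H -> measurable B ->
    P (H `&` x t.+1 @^-1` B) = \int[P]_(w in H) p (x t w) (a t w) (mu t) B }.

Definition expected_cost mu d0 (O : measurableType d0) (P : probability O R)
    (x : nat -> {RV P >-> X}) (a : nat -> {RV P >-> A}) : \bar R :=
  'E_P[fun w => total h (fun t => beta ^+ t * c (x t w) (a t w) (mu t))%R].

(* The expected cost of a policy is the one of any process it generates: such
   processes exist (Ionescu-Tulcea) and all have the same law on the stages. *)
Definition optimal_policy pi mu : Prop :=
  forall (pi' : nat -> R.-pker X ~> A)
    d1 (O1 : measurableType d1) (P1 : probability O1 R)
    (x1 : nat -> {RV P1 >-> X}) (a1 : nat -> {RV P1 >-> A})
    d2 (O2 : measurableType d2) (P2 : probability O2 R)
    (x2 : nat -> {RV P2 >-> X}) (a2 : nat -> {RV P2 >-> A}),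
  controlled_process pi mu x1 a1 -> controlled_process pi' mu x2 a2 ->
  expected_cost mu x1 a1 <= expected_cost mu x2 a2.

(* Measures are compared on measurable sets only: the library leaves their
   values elsewhere unconstrained. *)
Record mean_field_equilibrium pi mu : Prop := {
  mfe_initial : forall B, measurable B -> mu 0%N B = mu0 B ;
  mfe_optimal : optimal_policy pi mu ;
  mfe_flow : forall t, stage h t.+1 -> forall B, measurable B ->
    mu t.+1 B = \int[mu t]_x \int[pi t x]_a p x a (mu t) B }.

End mean_field_game.

(* Main.v *)
From HB Require Import structures.
Require Import Defs.
From mathcomp Require Import all_boot all_order all_algebra.
From mathcomp Require Import all_classical all_reals all_analysis.
From mathcomp Require Import measurable_realfun ring lra.

Set Implicit Arguments.
Unset Strict Implicit.
Unset Printing Implicit Defensive.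

Import Order.TTheory GRing.Theory Num.Theory.
Import numFieldNormedType.Exports.

Local Open Scope classical_set_scope.
Local Open Scope ring_scope.

(* Let V_N(mu, x) be the optimal N-stage cost of a player who starts in x and
   faces the flow mu.  Since A and X are compact and c, p are continuous on
   X x A x P(X), backward induction shows that V_N is jointly continuous, hence
   V_N(mu^T, .) -> V_N(mu, .) uniformly when mu^T_t -> mu_t for all t.  With
   |c| <= M, an equilibrium of a T-horizon game with T >= N pays at most
   \int V_N(mu^T, .) dmu0 + 2 M beta^N / (1 - beta) during its first N stages:
   otherwise a measurable selector of almost minimizing actions, played during
   these stages, would do better.  This passes to the limit in T, since the cost
   of the first N stages is continuous in the joint laws pi_t (x) mu_t, and any
   policy facing mu pays at least \int V_N(mu, .) dmu0 during these stages; now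
   let N tend to infinity.  The flow equation is tested against continuous
   functions in the same way.
   The bound M requires the compactness of P(X), which is obtained from the Riesz
   representation theorem applied to limits of integrals along ultrafilters.
   Sequential continuity of c and p upgrades to continuity because P(X) is first
   countable. *)

(** * Integrals of bounded measurable functions *)

(** The kernels of the finite-horizon equilibria need not converge, only the joint laws do, so
    neither a policy nor the process it generates can be passed to the limit. Hence optimality is
    first rewritten as an inequality between quantities that see only the joint laws and the flow:
    on one side the cost of the first N stages, which the flow equation turns into integrals against
    the joint laws, on the other the value function, which does not mention policies. Costs are
    defined through processes, and optimality would be vacuous without any. To exploit it in a
    T-horizon game, processes for the equilibrium and for its competitor must be exhibited; finitely
    many one-step extensions suffice. In the infinite-horizon game the processes are given, so none
    has to be built. The selectors are only e-optimal: near minimizers can be searched for in a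
    countable dense set of actions, exact ones cannot. *)

Section bounded_integral.
Context d (T : measurableType d) (R : realType).
Implicit Types (P : probability T R) (f g : T -> R).

Definition bmeasurable f :=
  measurable_fun setT f /\ exists M, forall x, `|f x| <= M.

Lemma bmeasurableW f M : measurable_fun setT f -> (forall x, `|f x| <= M) ->
  bmeasurable f.
Proof. by move=> mf fM; split => //; exists M. Qed.

Lemma bmeasurable_integrable P f : bmeasurable f ->
  P.-integrable setT (EFin \o f).
Proof.
move=> [mf [M fM]]; apply: measurable_bounded_integrable => //.
  by apply: le_lt_trans (ltry 1); rewrite [leLHS](probability_setT P).
exists M; split; first exact: num_real.
by move=> y My x _; exact: le_trans (fM x) (ltW My).
Qed.

Lemma bmeasurable_cst k : bmeasurable (cst k).
Proof. by split; [exact: measurable_cst|exists `|k|]. Qed.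

Lemma bmeasurableD f g : bmeasurable f -> bmeasurable g ->
  bmeasurable (fun x => f x + g x).
Proof.
move=> [mf [M fM]] [mg [N gN]]; split; first exact: measurable_funD.
by exists (M + N) => x; rewrite (le_trans (ler_normD _ _))// lerD.
Qed.

Lemma bmeasurableZ k f : bmeasurable f -> bmeasurable (fun x => k * f x).
Proof.
move=> [mf [M fM]]; split; first exact: measurable_funM.
by exists (`|k| * M) => x; rewrite normrM ler_wpM2l.
Qed.

Lemma bmeasurableB f g : bmeasurable f -> bmeasurable g ->
  bmeasurable (fun x => f x - g x).
Proof.
move=> [mf [M fM]] [mg [N gN]]; split; first exact: measurable_funB.
by exists (M + N) => x; rewrite (le_trans (ler_normB _ _))// lerD.
Qed.

Lemma bmeasurable_sum n (u : nat -> T -> R) : (forall i, bmeasurable (u i)) ->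
  bmeasurable (fun x => \sum_(i < n) u i x).
Proof.
move=> hu; elim: n => [|n IH].
  rewrite (_ : (fun _ => _) = cst 0); first exact: bmeasurable_cst.
  by apply/funext => x; rewrite big_ord0.
rewrite (_ : (fun _ => _) = (fun x => \sum_(i < n) u i x + u n x)).
  exact: bmeasurableD.
by apply/funext => x; rewrite big_ord_recr.
Qed.

Lemma EFin_Rintegral P f : bmeasurable f ->
  ((\int[P]_x f x)%:E = \int[P]_x (f x)%:E)%E.
Proof.
move=> bf; rewrite fineK//; apply: integrable_fin_num => //.
exact: bmeasurable_integrable.
Qed.

Lemma bRintegral_cst P k : \int[P]_x (cst k x) = k.
Proof. by rewrite Rintegral_cst// [X in fine X](probability_setT P) mulr1. Qed.

Lemma bRintegralD P f g : bmeasurable f -> bmeasurable g ->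
  \int[P]_x (f x + g x) = \int[P]_x f x + \int[P]_x g x.
Proof. by move=> bf bg; rewrite RintegralD//; exact: bmeasurable_integrable. Qed.

Lemma bRintegralB P f g : bmeasurable f -> bmeasurable g ->
  \int[P]_x (f x - g x) = \int[P]_x f x - \int[P]_x g x.
Proof. by move=> bf bg; rewrite RintegralB//; exact: bmeasurable_integrable. Qed.

Lemma bRintegralZ P k f : bmeasurable f ->
  \int[P]_x (k * f x) = k * \int[P]_x f x.
Proof. by move=> bf; rewrite RintegralZl//; exact: bmeasurable_integrable. Qed.

Lemma bRintegral_sum P n (u : nat -> T -> R) : (forall i, bmeasurable (u i)) ->
  \int[P]_x (\sum_(i < n) u i x) = \sum_(i < n) \int[P]_x u i x.
Proof.
move=> hu; elim: n => [|n IH].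
  rewrite big_ord0 -[RHS](bRintegral_cst P 0); apply: eq_Rintegral => x _.
  by rewrite big_ord0.
rewrite big_ord_recr/= -IH.
rewrite -[RHS](bRintegralD P (bmeasurable_sum n hu) (hu n)).
by apply: eq_Rintegral => x _; rewrite big_ord_recr.
Qed.

Lemma le_bRintegral P f g : bmeasurable f -> bmeasurable g ->
  (forall x, f x <= g x) -> \int[P]_x f x <= \int[P]_x g x.
Proof.
by move=> bf bg fg; apply: le_Rintegral => //; exact: bmeasurable_integrable.
Qed.

Lemma bRintegral_le P f k : bmeasurable f -> (forall x, f x <= k) ->
  \int[P]_x f x <= k.
Proof.
move=> bf fk; rewrite -[leRHS](bRintegral_cst P k).
by apply: le_bRintegral => //; exact: bmeasurable_cst.
Qed.

Lemma bRintegral_norm P f k : bmeasurable f -> (forall x, `|f x| <= k) ->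
  `|\int[P]_x f x| <= k.
Proof.
move=> bf fk; rewrite ler_norml; apply/andP; split; last first.
  by apply: bRintegral_le => // x; rewrite (le_trans (ler_norm _)).
rewrite -[leLHS](bRintegral_cst P (- k)).
apply: le_bRintegral => //; first exact: bmeasurable_cst.
by move=> x; have := fk x; rewrite ler_norml => /andP[].
Qed.

Lemma bRintegral_dist P f g k : bmeasurable f -> bmeasurable g ->
  (forall x, `|f x - g x| <= k) -> `|\int[P]_x f x - \int[P]_x g x| <= k.
Proof.
move=> bf bg fg; rewrite -bRintegralB//.
by apply: bRintegral_norm => //; exact: bmeasurableB.
Qed.

Lemma bRintegral_indic P B : measurable B -> \int[P]_x \1_B x = fine (P B).
Proof. by move=> mB; rewrite /Rintegral integral_indic// setIT. Qed.

Lemma bmeasurable_indic B : measurable B -> bmeasurable (\1_B : T -> R).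
Proof.
move=> mB; split; first exact: measurable_indic.
by exists 1 => x; rewrite indicE; case: (_ \in _); rewrite ?normr1 ?normr0.
Qed.

Lemma bRintegral_cvg P (u : nat -> T -> R) f M :
  (forall n, measurable_fun setT (u n)) -> (forall n x, `|u n x| <= M) ->
  (forall x, u n x @[n --> \oo] --> f x) ->
  \int[P]_x u n x @[n --> \oo] --> \int[P]_x f x.
Proof.
move=> mu uM uf.
have mf : measurable_fun setT f.
  by apply: measurable_realfun.measurable_fun_cvg => // x _; exact: uf.
have fM x : `|f x| <= M.
  have h : `|u n x| @[n --> \oo] --> `|f x| by apply: cvg_norm; exact: uf.
  by apply: (cvgr_to_le h); exact: nearW.
have bu n : bmeasurable (u n) by split => //; exists M.
have bf : bmeasurable f by split => //; exists M.
suff : (\int[P]_x u n x)%:E @[n --> \oo] --> (\int[P]_x f x)%:E.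
  by move=> /fine_cvgP[].
rewrite EFin_Rintegral//.
under eq_fun do rewrite EFin_Rintegral//.
apply: (@dominated_cvg _ _ _ _ _ measurableT _ _ (cst M%:E)) => //.
- by move=> n; exact/measurable_EFinP.
- by move=> x _; apply: cvg_EFin; [exact: nearW|exact: uf].
- by apply: (bmeasurable_integrable P (bmeasurable_cst M)).
- by move=> n x _; rewrite lee_fin.
Qed.

End bounded_integral.

(** * Weak convergence and continuous functions *)

Section measurable_continuous.
Context (R : realType).

Lemma continuous_measurable d (T : borelType d) (f : T -> R) :
  continuous f -> measurable_fun setT f.
Proof.
move=> /continuousP cf; apply: (measurability _ (RGenOpens.measurableE R)).
move=> _ [_ [a [b ->] <-]]; rewrite setTI measurable_borel.
by apply: sub_sigma_algebra; exact/cf/interval_open.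
Qed.

Lemma open_borel d (T : borelType d) (U : set T) : open U -> measurable U.
Proof. by move=> oU; rewrite measurable_borel; exact: sub_sigma_algebra. Qed.

Definition basis_seq (T : topologicalType) (b : nat -> set T) :=
  (forall n, open (b n)) /\
  forall x U, nbhs x U -> exists n, b n x /\ b n `<=` U.

Lemma second_countable_seq (T : topologicalType) :
  @second_countable T -> exists b : nat -> set T, basis_seq b.
Proof.
move=> [B /countable_injP[f] finj [oB bB]].
(* As [f] is injective on [B], this union has at most one member: the basic set with code [n], or
   nothing when [n] is not a code. *)
exists (fun n => \bigcup_(U in B `&` [set U | f U = n]) U); split.
  by move=> n; apply: bigcup_open => U [/oB].
move=> x U /bB[V [BV Vx] VU]; exists (f V); split; first by exists V.
move=> y [W [BW fW] Wy]; apply: VU.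
by rewrite -(finj W V) ?inE.
Qed.

(** An open subset of the product is the union of the countably many basic rectangles it contains,
    hence lies in the product sigma-algebra. *)
Lemma continuous_measurable_prod d1 d2 (T1 : borelType d1) (T2 : borelType d2)
    (b1 : nat -> set T1) (b2 : nat -> set T2) (f : T1 * T2 -> R) :
  basis_seq b1 -> basis_seq b2 -> continuous f -> measurable_fun setT f.
Proof.
move=> [ob1 hb1] [ob2 hb2] /continuousP cf.
apply: (measurability _ (RGenOpens.measurableE R)).
move=> _ [_ [a [b ->] <-]]; rewrite setTI.
have {cf} := cf _ (@interval_open _ (BRight a) (BLeft b) isT isT).
set W := f @^-1` _ => oW.
have -> : W = \bigcup_ij (if `[< b1 ij.1 `*` b2 ij.2 `<=` W >]
                          then b1 ij.1 `*` b2 ij.2 else set0).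
  apply/seteqP; split => [[x y] Wxy|z [ij _]]; last by case: asboolP => // h /h.
  have : nbhs (x, y) W by exact: open_nbhs_nbhs.
  case=> -[U V] /= [/hb1[i [ix iU]] /hb2[j [jy jV]]] UVW.
  exists (i, j) => //=; case: asboolP => // -[].
  by move=> [u v] /= [iu jv]; apply: UVW; split; [exact: iU|exact: jV].
apply: countable_bigcupT_measurable => // -[i j] /=; case: ifPn => // _.
by apply: measurableX; exact: open_borel.
Qed.

Lemma prod_topology_cvgP (I : Type) (K : I -> topologicalType)
    (F : set_system (prod_topology K)) (f : prod_topology K) : Filter F ->
  F --> f <-> (forall i, g i @[g --> F] --> f i).
Proof.
move=> FF; split => [/cvg_sup h i|h].
  apply: cvg_trans (@initial_continuous _ _ (fun g : forall i, K i => g i) f).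
  exact: cvg_fmap2 (h i).
apply/cvg_sup => i.
move=> A /= [_ [[B Bop <-] Bfs sBfA]].
rewrite nbhs_filterE; apply: filterS sBfA _.
by apply: h; exact: open_nbhs_nbhs.
Qed.

Lemma weak_cvgP d (T : measurableTopologicalType d)
    (F : set_system (wprobability T R)) (P : wprobability T R) :
  Filter F ->
  F --> P <-> (forall f : T -> R, continuous f -> bounded_fun f ->
   \int[Q]_x f x @[Q --> F] --> \int[P]_x f x).
Proof.
move=> FF; split => [FP f cf bf|h].
  have := @initial_continuous _ _ (@weak_pairing d T R) P.
  move=> /(cvg_comp _ _ FP)/prod_topology_cvgP.
  by move=> /(_ (exist _ f (conj cf bf))).
suff : @weak_pairing d T R @ F --> weak_pairing P.
  move=> h' A [_ [[B Bop <-] BfP sBA]].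
  by rewrite nbhs_filterE; apply: filterS sBA _; apply: h'; exact: open_nbhs_nbhs.
by apply/prod_topology_cvgP => -[f [cf bf]]; exact: h.
Qed.

Lemma bounded_fun_normP (T : Type) (f : T -> R) :
  bounded_fun f <-> exists M, forall x, `|f x| <= M.
Proof.
split=> [[M [_ h]]|[M h]].
  by exists (M + 1) => x; apply: h => //; rewrite ltrDl.
by exists M; split; [exact: num_real|move=> y My x _; exact: le_trans (h x) (ltW My)].
Qed.

Lemma compact_bounded_fun (T : topologicalType) (f : T -> R) :
  compact [set: T] -> continuous f -> bounded_fun f.
Proof.
move=> cT cf.
have /compact_bounded[M [_ h]] : compact (f @` setT).
  by apply: continuous_compact => //; exact/continuous_subspaceT.
apply/bounded_fun_normP; exists (M + 1) => x; apply: h; last exact: imageT.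
by rewrite ltrDl.
Qed.

End measurable_continuous.

(** * Lipschitz approximations of the indicator of an open set *)

Section bump.
Context (R : realType) d (X : borelMetricType R d).
Implicit Types (U : set X) (n : nat) (x : X).

(* The singleton 1 keeps the infimum meaningful when [~` U] is empty. *)
Let slopes U n x := [set 1] `|` [set n%:R * mdist x y | y in ~` U].

Let slopes0 U n x : slopes U n x !=set0.
Proof. by exists 1; left. Qed.

Let slopes_ge0 U n x : lbound (slopes U n x) 0.
Proof. by move=> _ [->|[y _ <-]]//; rewrite mulr_ge0// mdist_ge0. Qed.

Let slopes_lb U n x : has_lbound (slopes U n x).
Proof. by exists 0; exact: slopes_ge0. Qed.

(** This is min(1, n d(x, X \ U)), which increases to the indicator of an open [U] as [n] grows. *)
Definition open_bump U n x : R := inf (slopes U n x).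

Lemma open_bump_ge0 U n x : 0 <= open_bump U n x.
Proof. by apply: lb_le_inf => //; exact: slopes_ge0. Qed.

Lemma open_bump_le1 U n x : open_bump U n x <= 1.
Proof. by apply: ge_inf => //; left. Qed.

Lemma open_bump_norm U n x : `|open_bump U n x| <= 1.
Proof. by rewrite ger0_norm ?open_bump_ge0// open_bump_le1. Qed.

Lemma open_bump_eq0 U n x : ~ U x -> open_bump U n x = 0.
Proof.
move=> Ux; apply/eqP; rewrite eq_le open_bump_ge0 andbT; apply: ge_inf => //.
by right; exists x => //; rewrite mdistxx mulr0.
Qed.

(** Around [x] a ball of radius e/2 keeps distance at least e/2 from the complement, so one rank
    serves the whole ball. This local uniformity is what the compactness argument in
    [content_bigcup] needs. *)
Lemma open_bump_eq1 U x : open U -> U x ->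
  \forall x' \near x & n \near \oo, open_bump U n x' = 1.
Proof.
move=> oU Ux.
have [e /= e0 eU] : exists2 e, 0 < e & ball x e `<=` U.
  by apply/nbhs_ballP; exact: open_nbhs_nbhs.
exists (ball x (e / 2), [set n | 2 / e <= n%:R]).
  split => /=; first by apply: nbhsx_ballx; rewrite divr_gt0.
  exact: nbhs_infty_ger.
move=> [x' n] /= [xx' en]; apply/eqP; rewrite eq_le open_bump_le1/=.
apply: lb_le_inf => // _ [->//|[y Uy <-]].
have : e / 2 <= mdist x' y.
  rewrite leNgt; apply/negP => x'y; apply: Uy; apply: eU.
  by rewrite (splitr e); apply: ball_triangle xx' _; rewrite ballEmdist.
move=> h; apply: le_trans (ler_pM _ _ en h).
- by rewrite -invf_div mulVf// gt_eqF// divr_gt0.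
- by rewrite divr_ge0// ltW.
- by rewrite divr_ge0// ltW.
Qed.

Lemma open_bump_lip U n x x' : open_bump U n x <= open_bump U n x' + n%:R * mdist x x'.
Proof.
rewrite -lerBlDr; apply: lb_le_inf => // _ [->|[y Uy <-]].
  rewrite lerBlDr (le_trans (open_bump_le1 _ _ _))// lerDl mulr_ge0//.
  exact: mdist_ge0.
rewrite lerBlDr -mulrDr.
apply: le_trans (_ : n%:R * mdist x y <= _).
  by apply: ge_inf => //; right; exists y.
by rewrite ler_wpM2l// addrC metric_triangle.
Qed.

Lemma open_bump_continuous U n : continuous (open_bump U n).
Proof.
move=> x; apply/cvgrPdist_le => e e0.
have xn : \forall x' \near x, mdist x x' < e / n.+1%:R.
  apply/nbhs_ballP; exists (e / n.+1%:R) => /=; first by rewrite divr_gt0.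
  by move=> y; rewrite ballEmdist.
near=> x'.
have h : n%:R * mdist x x' <= e.
  apply: (@le_trans _ _ (n.+1%:R * mdist x x')).
    by rewrite ler_wpM2r ?mdist_ge0// ler_nat.
  rewrite mulrC -ler_pdivlMr//; apply: ltW; near: x'.
  exact: xn.
rewrite ler_distl; apply/andP; split; [rewrite lerBlDr|].
  by rewrite (le_trans (open_bump_lip U n x' x))// lerD2l// metric_sym.
by rewrite (le_trans (open_bump_lip U n x x'))// lerD2l.
Unshelve. all: by end_near. Qed.

Lemma open_bump_bmeasurable U n : bmeasurable (open_bump U n).
Proof.
apply: (@bmeasurableW _ _ _ _ 1); last exact: open_bump_norm.
by apply: continuous_measurable; exact: open_bump_continuous.
Qed.

Lemma open_bump_cvg (P : probability X R) U : open U ->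
  (\int[P]_x open_bump U n x)%:E @[n --> \oo] --> P U.
Proof.
move=> oU.
rewrite -[P U]fineK; last exact: fin_num_measure (open_borel oU).
apply: cvg_EFin; first exact: nearW.
rewrite -bRintegral_indic; last exact: open_borel.
apply: (@bRintegral_cvg _ _ _ _ _ _ 1).
- by move=> n; have [] := open_bump_bmeasurable U n.
- by move=> n x; exact: open_bump_norm.
move=> x; rewrite indicE; have [/set_mem Ux|/negP Ux] := boolP (x \in U).
  apply: cvg_near_cst; have [[/= V W] [Vx Woo] h] := open_bump_eq1 oU Ux.
  apply: filterS Woo => n Wn; apply: (h (x, n)); split => //=.
  exact: nbhs_singleton.
apply: cvg_near_cst; apply: nearW => n; rewrite open_bump_eq0//.
by move=> ?; apply: Ux; exact: mem_set.
Qed.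

Lemma setI_closed_open : setI_closed (open : set (set X)).
Proof. by move=> A B; exact: openI. Qed.

(** The mass of an open set is the limit of the integrals of its bumps, and the open sets form a
    generating pi-system. *)
Lemma continuous_Rintegral_unique (P Q : probability X R) :
  (forall f : X -> R, continuous f -> \int[P]_x f x = \int[Q]_x f x) ->
  forall B, measurable B -> P B = Q B.
Proof.
move=> h B mB.
apply: (@measure_unique _ R X open (fun=> setT)) => //.
- exact: measurable_borel.
- exact: setI_closed_open.
- by move=> _; exact: openT.
- by rewrite bigcup_const.
- move=> U oU; have := @open_bump_cvg P U oU; have := @open_bump_cvg Q U oU.
  under eq_fun do rewrite -(h _ (@open_bump_continuous U _)).
  by move=> /cvg_lim hQ /cvg_lim hP; rewrite -[LHS]hP// -[RHS]hQ.
- by move=> _; apply: le_lt_trans (ltry 1); rewrite [leLHS](probability_setT P).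
Qed.

(** The sets with measurable mass form a Dynkin system, which contains the open sets by
    approximation with bumps. This is how weak continuity of [p] makes it a kernel. *)
Lemma measurable_fun_kernel d' (O : measurableType d')
    (k : O -> probability X R) :
  (forall f : X -> R, continuous f -> bounded_fun f ->
    measurable_fun setT (fun w => \int[k w]_x f x)) ->
  forall B, measurable B -> measurable_fun setT (fun w => k w B).
Proof.
move=> h B; rewrite measurable_borel.
apply: (@dynkin_induction _ X open
  [set B | measurable_fun setT (fun w => k w B)]) => //.
- exact: measurable_borel.
- exact: setI_closed_open.
- rewrite /= (_ : (fun _ => _) = cst 1%E); first exact: measurable_cst.
  by apply/funext => w; exact: probability_setT.
- move=> U oU /=.
  apply: (@emeasurable_fun_cvg _ _ _ _ (fun n w => (\int[k w]_x open_bump U n x)%:E)).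
    move=> n; apply/measurable_EFinP; apply: h; first exact: open_bump_continuous.
    by apply/bounded_fun_normP; exists 1 => x; exact: open_bump_norm.
  by move=> w _; exact: open_bump_cvg.
- move=> S mS /= hS.
  rewrite (_ : (fun _ => _) = (fun w => 1 - k w S)%E).
    by apply: emeasurable_funB => //; exact: measurable_cst.
  by apply/funext => w; exact: probability_setC.
- move=> F mF tF hF /=.
  rewrite (_ : (fun _ => _) = (fun w => \sum_(0 <= n <oo) k w (F n))%E).
    apply: ge0_emeasurable_sum; last by move=> i _; exact: hF.
    by move=> *; exact: measure_ge0.
  apply/funext => w; rewrite [LHS]measure_bigcup//; apply: eq_eseriesl => n.
  by rewrite in_setT.
Qed.

End bump.

(** * Riesz representation on a compact metric space *)

Section riesz.
Context (R : realType) d (X : borelMetricType R d).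
Hypothesis compactX : compact [set: X].
Variable Lam : (X -> R) -> R.
Hypothesis Lam_le : forall f g : X -> R, continuous f -> continuous g ->
  (forall x, f x <= g x) -> Lam f <= Lam g.
Hypothesis LamD : forall f g : X -> R, continuous f -> continuous g ->
  Lam (fun x => f x + g x) = Lam f + Lam g.
Hypothesis LamZ : forall k (f : X -> R), continuous f ->
  Lam (fun x => k * f x) = k * Lam f.
Hypothesis Lam1 : Lam (cst 1) = 1.

Let Lam_cst k : Lam (cst k) = k.
Proof.
rewrite (_ : cst k = (fun x => k * cst 1 x)); last first.
  by apply/funext => x; rewrite /= mulr1.
by rewrite LamZ ?Lam1 ?mulr1//; move=> x; exact: cvg_cst.
Qed.

Let Lam_sum n (u : nat -> X -> R) : (forall i, continuous (u i)) ->
  continuous (fun x => \sum_(i < n) u i x) /\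
  Lam (fun x => \sum_(i < n) u i x) = \sum_(i < n) Lam (u i).
Proof.
move=> cu; elim: n => [|n [IHc IH]].
  rewrite big_ord0 (_ : (fun _ => _) = cst 0) ?Lam_cst.
    by split => // x; exact: cvg_cst.
  by apply/funext => x; rewrite big_ord0.
rewrite (_ : (fun _ => _) = (fun x => \sum_(i < n) u i x + u n x)).
  rewrite LamD// IH big_ord_recr; split => // x.
  by apply: cvgD; [exact: IHc|exact: cu].
by apply/funext => x; rewrite big_ord_recr.
Qed.

(** Functions that merely vanish off [U] replace the usual ones with support inside [U]; the bumps
    of [U] are among them. *)
Let below (U : set X) := [set f : X -> R |
  [/\ continuous f, (forall x, 0 <= f x <= 1) & forall x, ~ U x -> f x = 0]].

Let content (U : set X) := sup (Lam @` below U).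

Let below0 U : below U (cst 0).
Proof. by split => // [x|x]; [exact: cvg_cst|rewrite lexx ler01]. Qed.

Let below_ub U f : below U f -> Lam f <= 1.
Proof.
move=> [cf f01 _]; rewrite -[leRHS](Lam_cst 1); apply: Lam_le => //.
  by move=> x; exact: cvg_cst.
by move=> x; have /andP[] := f01 x.
Qed.

Let content_has_sup U : has_sup (Lam @` below U).
Proof.
split; first by exists (Lam (cst 0)), (cst 0).
by exists 1 => _ [f /below_ub ? <-].
Qed.

Let le_content U f : below U f -> Lam f <= content U.
Proof.
by move=> Uf; apply: ub_le_sup; [exact: (content_has_sup U).2|exists f].
Qed.

Let content_le U k : (forall f, below U f -> Lam f <= k) -> content U <= k.
Proof.
move=> h; apply: ge_sup; first exact: (content_has_sup U).1.
by move=> _ [f Uf <-]; exact: h.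
Qed.

Let content_ge0 U : 0 <= content U.
Proof. by rewrite -(Lam_cst 0); exact: le_content. Qed.

Let content_le1 U : content U <= 1.
Proof. by apply: content_le => f; exact: below_ub. Qed.

Let le_content_homo U V : U `<=` V -> content U <= content V.
Proof.
move=> UV; apply: content_le => f [cf f01 f0]; apply: le_content; split => //.
by move=> x Vx; apply: f0 => /UV.
Qed.

Let content_setT : content setT = 1.
Proof.
apply/eqP; rewrite eq_le content_le1/= -[leLHS](Lam_cst 1); apply: le_content.
by split => [x|x|x /(_ I)//]; [exact: cvg_cst|rewrite /= lexx ler01].
Qed.

Let below_open_bump U n : below U (open_bump U n).
Proof.
split; [exact: open_bump_continuous| |exact: open_bump_eq0].
by move=> x; rewrite open_bump_ge0 open_bump_le1.
Qed.

(** No partition of unity is needed: a function [f] below the union satisfies [f <= e +] the sum of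
    the first n bumps for some n. Indeed, near a point of [U k] the k-th bump is eventually 1, near
    any other point [f < e], and compactness makes the rank uniform. *)
Let content_bigcup (U : nat -> set X) : (forall n, open (U n)) ->
  ((content (\bigcup_n U n))%:E <= \sum_(n <oo) (content (U n))%:E)%E.
Proof.
move=> oU; set S := (X in (_ <= X)%E).
have S0 : (0 <= S)%E by apply: nneseries_ge0 => n _ _; rewrite lee_fin.
have [->|] := eqVneq S +oo%E; first by rewrite leey.
rewrite -ltey => Soo.
have Sfin : S \is a fin_num by rewrite ge0_fin_numE.
rewrite -(fineK Sfin) lee_fin; apply: content_le => f [cf f01 f0].
apply/ler_addgt0Pl => e e0.
have : \forall n \near \oo, [set: X] `<=`
    [set x | f x <= e + \sum_(i < n) open_bump (U i) n x].
  apply: (iffLR (compact_near_coveringP _) compactX nat \oo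
     (fun n x => f x <= e + \sum_(i < n) open_bump (U i) n x)) => x _.
  have [[k _ Ukx]|nUx] := pselect ((\bigcup_n U n) x).
    have h := open_bump_eq1 (oU k) Ukx.
    have h' : \forall x' \near x & n \near \oo, (k < n)%N.
      exists (setT, [set n | (k < n)%N]); last by move=> z [].
      by split; [exact: filterT|exact: nbhs_infty_gt].
    apply: filterS (filterI h h') => -[x' n] /= [b1 kn].
    rewrite (bigD1 (Ordinal kn))//= b1.
    have /andP[_ /le_trans->//] := f01 x'.
    rewrite addrCA lerDl addr_ge0 ?(ltW e0)// sumr_ge0// => i _.
    exact: open_bump_ge0.
  have fe : \forall x' \near x & n \near \oo, f x' < e.
    exists ([set x' | f x' < e], setT); last by move=> z [].
    by split; [apply: (cvgr_lt _ (cf x)); rewrite f0|exact: filterT].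
  apply: filterS fe => -[x' n] /= /ltW /le_trans -> //.
  by rewrite lerDl sumr_ge0// => i _; exact: open_bump_ge0.
case=> N _ /(_ N (leqnn N)) fN.
have [cs Ls] := Lam_sum N (fun i => @open_bump_continuous _ _ _ (U i) N).
have -> : Lam f <= Lam (fun x => cst e x + \sum_(i < N) open_bump (U i) N x) ->
   Lam f <= e + fine S.
  move=> /le_trans; apply; rewrite LamD//; last by move=> x; exact: cvg_cst.
  rewrite Lam_cst lerD2l Ls -lee_fin fineK// -sumEFin.
  apply: (@le_trans _ _ (\sum_(i < N) (content (U i))%:E)%E).
    by apply: lee_sum => i _; rewrite lee_fin; exact: le_content.
  rewrite -(big_mkord xpredT (fun i => (content (U i))%:E)).
  by apply: nneseries_lim_ge => n _; rewrite lee_fin.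
- by [].
apply: Lam_le => //.
  by move=> x; apply: cvgD; [exact: cvg_cst|exact: cs].
by move=> x; exact: fN.
Qed.

Let outer (E : set X) : \bar R :=
  (inf [set content U | U in [set U | open U /\ E `<=` U]])%:E.

Let outer_lb E : has_lbound [set content U | U in [set U | open U /\ E `<=` U]].
Proof. by exists 0 => _ [U _ <-]. Qed.

Let outer_le E U : open U -> E `<=` U -> (outer E <= (content U)%:E)%E.
Proof.
by move=> oU EU; rewrite lee_fin; apply: ge_inf => //; exists U.
Qed.

Let outer_ge E k :
  (forall U, open U -> E `<=` U -> k <= content U) -> (k%:E <= outer E)%E.
Proof.
move=> h; rewrite lee_fin; apply: lb_le_inf.
  by exists (content setT), setT; split => //; exact: openT.
by move=> _ [U [oU EU] <-]; exact: h.
Qed.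

Let outer_approx E e : 0 < e ->
  exists U, [/\ open U, E `<=` U & ((content U)%:E <= outer E + e%:E)%E].
Proof.
move=> e0.
have h : has_inf [set content U | U in [set U | open U /\ E `<=` U]].
  split; last exact: outer_lb.
  by exists (content setT), setT; split => //; exact: openT.
have [_ [U [oU EU] <-] Ue] := inf_adherent e0 h.
by exists U; split => //; rewrite /outer -EFinD lee_fin ltW.
Qed.

Let outer_open U : open U -> outer U = (content U)%:E.
Proof.
move=> oU; apply/eqP; rewrite eq_le outer_le//=.
by apply: outer_ge => V oV UV; exact: le_content_homo.
Qed.

Let outer0 : outer set0 = 0%E.
Proof.
rewrite outer_open; last exact: open0.
congr EFin; apply/eqP; rewrite eq_le content_ge0 andbT.
apply: content_le => f [_ _ f0].
rewrite (_ : f = cst 0) ?Lam_cst//.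
by apply/funext => x; exact: f0.
Qed.

Let outer_ge0 E : (0 <= outer E)%E.
Proof. exact: outer_ge. Qed.

Let le_outer : {homo outer : E F / E `<=` F >-> (E <= F)%E}.
Proof.
move=> E F EF; apply: outer_ge => U oU FU.
by rewrite -lee_fin; apply: outer_le => // x /EF/FU.
Qed.

Let outer_sigma_subadditive : sigma_subadditive outer.
Proof.
move=> F; apply/lee_addgt0Pr => e e0.
have e2 n : 0 < e / (2 ^ n.+1)%:R by rewrite divr_gt0// ltr0n expn_gt0.
have /choice[U hU] : forall n, exists U, [/\ open U, F n `<=` U &
    ((content U)%:E <= outer (F n) + (e / (2 ^ n.+1)%:R)%:E)%E].
  by move=> n; exact: outer_approx.
apply: le_trans (_ : _ <= (content (\bigcup_n U n))%:E)%E _.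
  apply: outer_le.
    by apply: bigcup_open => n _; have [] := hU n.
  by move=> x [n _ Fx]; exists n => //; have [_ + _] := hU n; exact.
apply: le_trans (content_bigcup _) _; first by move=> n; have [] := hU n.
apply: le_trans (epsilon_trick xpredT _ (ltW e0)) => //.
by apply: lee_nneseries => [n _ _|n _]; [rewrite lee_fin|have [] := hU n].
Qed.

HB.instance Definition _ := isOuterMeasure.Build R X outer
  outer0 outer_ge0 le_outer outer_sigma_subadditive.

(** Choose an open [V] containing [E] and [f] almost optimal below the intersection of [V] and [U].
    The part of [E] outside [U] lies in the open set [W] where [f] is small, and any [g] below [W]
    satisfies [f + g <= 1 + e / 4], so after rescaling [f + g] is below [V]. *)
Let open_caratheodory (U : set X) : open U -> outer.-caratheodory U.
Proof.
move=> oU; apply: le_caratheodory_measurable => E.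
apply/lee_addgt0Pr => e e0.
(* Four errors of this size add up to [e]: the choices of [V], [f] and [g], and the rescaling of
   [f + g]. *)
have e3 : 0 < e / 4 by rewrite divr_gt0.
have [V [oV EV Ve]] := outer_approx E e3.
have /(sup_adherent e3)[_ [f [cf f01 f0] <-] hf] := content_has_sup (V `&` U).
pose W := V `&` [set x | f x < e / 4].
have oW : open W.
  apply: openI => //; move/continuousP : cf => /(_ _ (@open_lt _ (e / 4))).
  by [].
have /(sup_adherent e3)[_ [g [cg g01 g0] <-] hg] := content_has_sup W.
have fg : below V (fun x => (1 + e / 4)^-1 * (f x + g x)).
  have e1 : 0 < 1 + e / 4 by lra.
  split.
  - move=> x; apply: cvgM; first exact: cvg_cst.
    by apply: cvgD; [exact: cf|exact: cg].
  - move=> x; have /andP[fx0 fx1] := f01 x; have /andP[gx0 gx1] := g01 x.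
    rewrite mulr_ge0 ?invr_ge0 ?(ltW e1)//= ?addr_ge0//.
    rewrite mulrC ler_pdivrMr// mul1r.
    have [fe|fe] := ltP (f x) (e / 4); first lra.
    rewrite g0; first lra.
    by move=> [_ /=]; rewrite ltNge fe.
  - move=> x Vx; rewrite f0 ?g0 ?addr0 ?mulr0//; first by move=> [].
    by move=> [].
have := le_content fg; rewrite LamZ; last first.
  by move=> x; apply: cvgD; [exact: cf|exact: cg].
rewrite LamD// mulrC ler_pdivrMr; last lra.
move=> hV.
have hU : (outer (E `&` U) <= (content (V `&` U))%:E)%E.
  by apply: outer_le; [exact: openI|move=> x [/EV]].
have hW : (outer (E `&` ~` U) <= (content W)%:E)%E.
  apply: outer_le => // x [/EV Vx Ux]; split => //=; rewrite f0//.
  by move=> [].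
apply: le_trans (leeD hU hW) _.
apply: le_trans (_ : _ <= (content V)%:E + (e / 4 * 3)%:E)%E _.
  rewrite -!EFinD lee_fin.
  have hf' : content (V `&` U) - e / 4 < Lam f := hf.
  have hg' : content W - e / 4 < Lam g := hg.
  have : content V * (e / 4) <= e / 4 by rewrite ler_piMl ?content_le1// ltW.
  move: hV; rewrite mulrDr mulr1; lra.
apply: le_trans (leeD2r _ Ve) _.
rewrite -addeA leeD2l// -EFinD lee_fin; lra.
Qed.

Let borel_caratheodory (B : set X) : measurable B -> outer.-caratheodory B.
Proof.
rewrite measurable_borel.
suff : <<s (open : set (set X)) >> `<=` (outer.-cara.-measurable : set (set X)).
  exact.
apply: smallest_sub; first exact: sigma_algebra_measurable.
exact: open_caratheodory.
Qed.

Let outer_sigma_additive : semi_sigma_additive (outer : set X -> \bar R).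
Proof.
move=> F mF tF mUF.
apply: (@caratheodory_measure_sigma_additive R X outer) => //.
- by move=> n; exact: borel_caratheodory.
- exact: borel_caratheodory.
Qed.

HB.instance Definition _ := isMeasure.Build _ X R outer
  outer0 outer_ge0 outer_sigma_additive.

Let outer_setT : outer setT = 1%E.
Proof. by rewrite outer_open ?content_setT//; exact: openT. Qed.

HB.instance Definition _ := Measure_isProbability.Build _ _ _ outer outer_setT.

Let P : probability X R := outer.

(* For 0 <= f <= 1, N f is the sum of its N layers, and the j-th layer is at
   most the indicator of {N f > j}. *)
Let level (f : X -> R) (N j : nat) (x : X) : R :=
  Num.max 0 (Num.min (N%:R * f x - j%:R) 1).

Let level_sum (f : X -> R) N x n : 0 <= f x ->
  \sum_(j < n) level f N j x = Num.min (N%:R * f x) n%:R.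
Proof.
move=> f0; have Nf : 0 <= N%:R * f x by rewrite mulr_ge0.
elim: n => [|n IH]; first by rewrite big_ord0 min_r.
rewrite big_ord_recr/= IH /level -natr1.
by rewrite /Num.max /Num.min; do !case: ifPn; rewrite -?leNgt; lra.
Qed.

(** The [+ 1] is a rounding error: at each [x], the number of j < N with j < N f(x) is at most N
    f(x) + 1. It disappears after division by [N] when [N] grows. *)
Let Lam_level (f : X -> R) N : continuous f -> (forall x, 0 <= f x <= 1) -> (0 < N)%N ->
  N%:R * Lam f <= N%:R * \int[P]_x f x + 1.
Proof.
move=> cf f01 N0.
have cl j : continuous (level f N j).
  move=> x; apply: (@continuous_max _ _ (cst 0) _ x); first exact: cvg_cst.
  apply: (@continuous_min _ _ _ (cst 1) x); last exact: cvg_cst.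
  apply: cvgB; last exact: cvg_cst.
  by apply: cvgM; [exact: cvg_cst|exact: cf].
have oU j : open [set x | j%:R < N%:R * f x].
  have : continuous (fun x => N%:R * f x).
    by move=> x; apply: cvgM; [exact: cvg_cst|exact: cf].
  by move=> /continuousP/(_ _ (@open_gt _ j%:R)).
have [_ Ls] := Lam_sum N cl.
rewrite -LamZ//.
have -> : (fun x => N%:R * f x) = (fun x => \sum_(j < N) level f N j x).
  apply/funext => x; have /andP[f0 f1] := f01 x.
  by rewrite level_sum// min_l// ler_piMr.
rewrite Ls.
have bf : bmeasurable f.
  apply: (@bmeasurableW _ _ _ _ 1); first exact: continuous_measurable.
  by move=> x; have /andP[f0 f1] := f01 x; rewrite ger0_norm.
have mU j := open_borel (oU j).
apply: (@le_trans _ _ (\sum_(j < N) \int[P]_x \1_[set x | j%:R < N%:R * f x] x)).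
  apply: ler_sum => j _; rewrite bRintegral_indic//.
  have -> : P [set x | j%:R < N%:R * f x] = (content [set x | j%:R < N%:R * f x])%:E.
    exact: outer_open (oU j).
  apply: le_content; split => //.
  - by move=> x; rewrite le_max lexx/= ge_max ler01 ge_min lexx orbT.
  - move=> x /= /negP; rewrite -leNgt => h; rewrite /level max_l//.
    by rewrite ge_min subr_le0 h.
rewrite -(bRintegral_sum P N (fun j => bmeasurable_indic R (mU j))).
rewrite -bRintegralZ// -[X in _ + X](bRintegral_cst P).
rewrite -(bRintegralD P (bmeasurableZ _ bf) (bmeasurable_cst _ 1)).
apply: le_bRintegral.
- exact: (bmeasurable_sum N (fun j => bmeasurable_indic R (mU j))).
- by apply: bmeasurableD; [exact: bmeasurableZ|exact: bmeasurable_cst].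
move=> x /=; have /andP[f0 f1] := f01 x.
have Nf : 0 <= N%:R * f x by rewrite mulr_ge0.
(* The bound [S <= n] feeds the other one: a new term 1 occurs only when n < N f(x), and then S + 1
   <= n + 1 <= N f(x) + 1. *)
suff : forall n, let S := \sum_(j < n) (\1_[set x | j%:R < N%:R * f x] x : R) in
   S <= N%:R * f x + 1 /\ S <= n%:R.
  by move=> /(_ N)[].
elim=> [|n [IH1 IH2]]; first by rewrite /= big_ord0; split => //; lra.
rewrite /= big_ord_recr/= -natr1 indicE.
have [/set_mem/= h|_] := boolP (x \in _); rewrite /=; split; lra.
Qed.

Let Lam_unit (f : X -> R) : continuous f -> (forall x, 0 <= f x <= 1) ->
  Lam f <= \int[P]_x f x.
Proof.
move=> cf f01; apply/ler_addgt0Pl => e e0.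
have [N /= eN] : exists N : nat, e^-1 < N%:R.
  by exists (Num.trunc e^-1).+1; exact: truncnS_gt.
have N0 : 0 < N%:R :> R by apply: lt_trans eN; rewrite invr_gt0.
have := @Lam_level f N cf f01; rewrite -(ltr0n R) => /(_ N0) h.
rewrite -(ler_pM2l N0) (le_trans h)// mulrDr addrC lerD2r.
by rewrite -ler_pdivrMr// mul1r ltW.
Qed.

Lemma riesz_representation :
  exists Q : probability X R, forall f : X -> R, continuous f ->
    \int[Q]_x f x = Lam f.
Proof.
exists P => f cf.
have ccst k : continuous (cst k : X -> R) by move=> x; exact: cvg_cst.
have [M fM] : exists M, forall x, `|f x| <= M.
  by apply/bounded_fun_normP; exact: compact_bounded_fun.
have bf : bmeasurable f by apply: bmeasurableW fM; exact: continuous_measurable.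
have bunit (g : X -> R) : continuous g -> (forall x, 0 <= g x <= 1) ->
    Lam g = \int[P]_x g x.
  move=> cg g01; apply/eqP; rewrite eq_le Lam_unit//=.
  (* The reverse inequality is [Lam_unit] for [1 - g]. *)
  have cg' : continuous (fun x => cst 1 x + (-1) * g x).
    move=> x; apply: cvgD; first exact: cvg_cst.
    by apply: cvgM; [exact: cvg_cst|exact: cg].
  have bg : bmeasurable g.
    apply: (@bmeasurableW _ _ _ _ 1); first exact: continuous_measurable.
    by move=> x; have /andP[? ?] := g01 x; rewrite ger0_norm.
  have := @Lam_unit _ cg'; rewrite LamD// ?LamZ//; last first.
    by move=> x; apply: cvgM; [exact: cvg_cst|exact: cg].
  rewrite Lam1 bRintegralD; [|exact: bmeasurable_cst|exact: bmeasurableZ].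
  rewrite bRintegral_cst bRintegralZ// => h.
  suff : 1 + -1 * Lam g <= 1 + -1 * \int[P]_x g x by lra.
  by apply: h => x; have /= := g01 x; lra.
(* Positive and at least [M], so that [(f + K) / (2 * K)] takes its values in [0, 1]. *)
pose K := `|M| + 1.
have K0 : 0 < K by rewrite ltr_wpDl.
pose g x := (2 * K)^-1 * (f x + cst K x).
have cfK : continuous (fun x => f x + cst K x).
  by move=> x; apply: cvgD; [exact: cf|exact: cvg_cst].
have := bunit g.
rewrite /g LamZ// LamD// Lam_cst bRintegralZ; last first.
  by apply: bmeasurableD => //; exact: bmeasurable_cst.
rewrite bRintegralD//; last exact: bmeasurable_cst.
rewrite bRintegral_cst => h.
have K2 : (2 * K)^-1 != 0 by rewrite invr_neq0// gt_eqF// mulr_gt0.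
suff /(mulfI K2)/addIr -> : (2 * K)^-1 * (Lam f + K) =
  (2 * K)^-1 * (\int[P]_x f x + K) by [].
apply: h.
  by move=> x; apply: cvgM; [exact: cvg_cst|exact: cfK].
move=> x; have := fM x; rewrite ler_norml => /andP[h1 h2].
have MK : M <= K by rewrite /K (le_trans (ler_norm M))// lerDl.
rewrite mulr_ge0/=; last 2 first.
- by rewrite invr_ge0 mulr_ge0// ltW.
- by rewrite /=; lra.
by rewrite mulrC ler_pdivrMr ?mulr_gt0// mul1r/=; lra.
Qed.

End riesz.

(** * The space of probability measures on a compact metric space *)

Section first_countable.

(** The neighbourhoods decrease, so that any choice of [u n] in [B n] gives a sequence converging to
    [x]. *)
Definition first_countable_at (T : topologicalType) (x : T) :=
  exists B : nat -> set T, [/\ forall n, nbhs x (B n),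
    {homo B : m n / (m <= n)%N >-> n `<=` m} &
    forall U, nbhs x U -> exists n, B n `<=` U].

Lemma basis_first_countable (T : topologicalType) (b : nat -> set T) (x : T) :
  basis_seq b -> first_countable_at x.
Proof.
move=> [ob hb].
pose C i := if `[< b i x >] then b i else setT.
have nC i : nbhs x (C i).
  rewrite /C; case: asboolP => bix; last exact: filterT.
  exact: open_nbhs_nbhs.
exists (fun n => \bigcap_(i in `I_n) C i); split.
- elim=> [|n IH]; first by rewrite II0 bigcap_set0; exact: filterT.
  apply: filterS (filterI IH (nC n)) => y [h hn] i /=.
  by rewrite ltnS leq_eqVlt => /predU1P[->//|]; exact: h.
- by move=> m n mn y h i /= im; apply: h => /=; exact: leq_trans mn.
- move=> U /hb[n [bnx bU]]; exists n.+1 => y /(_ n (ltnSn n)).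
  by rewrite /C; case: asboolP => // _; exact: bU.
Qed.

Lemma prod_first_countable (T U : topologicalType) (x : T) (y : U) :
  first_countable_at x -> first_countable_at y -> first_countable_at (x, y).
Proof.
move=> [B [nB dB hB]] [C [nC dC hC]]; exists (fun n => B n `*` C n); split.
- by move=> n; exists (B n, C n) => //; split; [exact: nB|exact: nC].
- by move=> m n mn z [/(dB _ _ mn) ? /(dC _ _ mn)].
- move=> V [[V1 V2] /= [/hB[n1 h1] /hC[n2 h2]] V12].
  exists (maxn n1 n2) => z [z1 z2]; apply: V12; split => /=.
    by apply: h1; apply: dB z1; exact: leq_maxl.
  by apply: h2; apply: dC z2; exact: leq_maxr.
Qed.

Lemma seq_continuous_at (T U : topologicalType) (f : T -> U) (x : T) :
  first_countable_at x ->
  (forall u : nat -> T, u @ \oo --> x -> f (u n) @[n --> \oo] --> f x) ->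
  {for x, continuous f}.
Proof.
move=> [B [nB dB hB]] h V nV; apply: contrapT => hV.
have /choice[u hu] : forall n, exists y, B n y /\ ~ V (f y).
  move=> n; apply: contrapT => /forallNP H; apply: hV.
  apply: filterS (nB n) => y By; apply: contrapT => Vy; exact: (H y).
have ux : u @ \oo --> x.
  move=> W /hB[n nW]; exists n => // m /= nm; apply: nW.
  by apply: (dB n m) => //; have [] := hu m.
have [N _ /(_ N (leqnn N))] := h u ux V nV.
by have [] := hu N.
Qed.

End first_countable.

Section uniform_limit.
Context (R : realType).

(** A form of the tube lemma. The parameter space is arbitrary because it will be that of flows, of
    flow-state pairs and of measures in turn. *)
Lemma compact_uniform_cvg (Z I : topologicalType) (f : I -> Z -> R) (i0 : I) :
  compact [set: Z] -> (forall z, {for (i0, z), continuous (fun iz => f iz.1 iz.2)}) ->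
  forall e, 0 < e -> \forall i \near i0, forall z, `|f i z - f i0 z| < e.
Proof.
move=> cZ cf e e0.
have : \forall i \near i0, [set: Z] `<=` [set z | `|f i z - f i0 z| < e].
  apply: (iffLR (compact_near_coveringP _) cZ _ _
    (fun i z => `|f i z - f i0 z| < e)) => z _.
  have e2 : 0 < e / 2 by rewrite divr_gt0.
  have /cvgrPdist_lt/(_ _ e2)[[/= V W] [iV zW] VW] := cf z.
  exists (W, V); first by [].
  move=> [z' i] /= [Wz' Vi].
  have h1 : `|f i0 z - f i z'| < e / 2 by exact: (VW (i, z')).
  have h2 : `|f i0 z - f i0 z'| < e / 2.
    by apply: (VW (i0, z')); split => //=; exact: nbhs_singleton.
  rewrite (splitr e) -(subrK (f i0 z) (f i z')) -addrA.
  by rewrite (le_lt_trans (ler_normD _ _))// ltrD// distrC.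
by apply: filterS => i h z; exact: h.
Qed.

End uniform_limit.

Section weak_compact.
Context (R : realType) d (X : borelMetricType R d).
Hypothesis compactX : compact [set: X].

Lemma continuous_bmeasurable (f : X -> R) : continuous f -> bmeasurable f.
Proof.
move=> cf; split; first exact: continuous_measurable.
by apply/bounded_fun_normP; exact: compact_bounded_fun.
Qed.

Lemma weak_cvg_compactP (F : set_system (wprobability X R))
    (P : wprobability X R) : Filter F ->
  F --> P <-> (forall f : X -> R, continuous f ->
   \int[Q]_x f x @[Q --> F] --> \int[P]_x f x).
Proof.
move=> FF; rewrite weak_cvgP; split => h f cf; last by move=> _; exact: h.
by apply: h => //; exact: compact_bounded_fun.
Qed.

(** The image of [F] clusters in a compact segment, and along an ultrafilter a cluster point is a
    limit. *)
Lemma ultra_bounded_cvg (T : Type) (F : set_system T) (u : T -> R) M :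
  UltraFilter F -> (forall t, `|u t| <= M) -> cvg (u @ F).
Proof.
move=> FU uM.
have := @segment_compact R (- M) M.
have FM : (u @ F) `[- M, M]%classic.
  apply: (@filterS _ F _ setT); last exact: filterT.
  by move=> t _; have := uM t; rewrite ler_norml /= in_itv.
move=> /(_ (u @ F) _ FM)[l [_ hl]].
apply/cvg_ex; exists l => V nV.
have [//|FnV] := in_ultra_setVsetC (u @^-1` V) FU.
by have [x [? ?]] := hl (~` V) V FnV nV.
Qed.

Lemma wprobability_compact : compact [set: wprobability X R].
Proof.
rewrite compact_ultra => F FU _.
pose I (f : X -> R) (Q : wprobability X R) : R := \int[Q]_x f x.
pose Lam (f : X -> R) : R := lim (I f @ F).
have cF (f : X -> R) : continuous f -> cvg (I f @ F).
  move=> cf; have bf := continuous_bmeasurable cf.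
  have [_ [M fM]] := bf; apply: (ultra_bounded_cvg (M := M) FU) => Q.
  exact: bRintegral_norm.
have [P hP] : exists P : probability X R, forall f : X -> R, continuous f ->
    \int[P]_x f x = Lam f.
  apply: riesz_representation => //.
  - move=> f g cf cg fg; apply: ler_lim; [exact: cF|exact: cF|].
    by apply: nearW => Q; apply: le_bRintegral => //; exact: continuous_bmeasurable.
  - move=> f g cf cg; rewrite /Lam -limD; [|exact: cF|exact: cF].
    rewrite (_ : I (fun x => f x + g x) = I f + I g)//.
    by apply/funext => Q; apply: bRintegralD; exact: continuous_bmeasurable.
  - move=> k f cf; rewrite /Lam (_ : I _ = (fun Q => k * I f Q)).
      by apply: cvg_lim => //; apply: cvgM; [exact: cvg_cst|exact: cF].
    by apply/funext => Q; apply: bRintegralZ; exact: continuous_bmeasurable.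
  - rewrite /Lam (_ : I _ = cst 1); first by apply: cvg_lim => //; exact: cvg_cst.
    by apply/funext => Q; exact: bRintegral_cst.
exists P; split => //=; apply/weak_cvg_compactP => f cf.
by rewrite hP//; exact: cF.
Qed.

Lemma mdist_continuous (z : X) : continuous (mdist z : X -> R).
Proof.
move=> x; apply/cvgrPdist_lt => e e0; apply/nbhs_ballP; exists e => //= y.
rewrite ballEmdist/= => xy; apply: le_lt_trans xy.
rewrite ler_distl; apply/andP; split.
  by rewrite lerBlDr (le_trans (metric_triangle _ x _)).
by rewrite (le_trans (metric_triangle _ y _))// lerD2l metric_sym.
Qed.

Let basisX : exists b : nat -> set X, basis_seq b.
Proof. exact/second_countable_seq/compact_second_countable. Qed.

Lemma dense_seq : exists z : nat -> X, forall (x : X) U, nbhs x U -> exists n, U (z n).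
Proof.
have [b [ob hb]] := basisX.
exists (fun n => xget point (b n)) => x U /hb[n [bnx bU]]; exists n.
by apply: bU; apply: xgetPex; exists x.
Qed.

(* With z dense, these functions form a countable uniformly dense family of
   continuous functions. *)
Definition cones (z : nat -> X) (s : seq (nat * rat)) (n : nat) (x : X) : R :=
  foldr (fun iq m => Num.min (ratr iq.2 + n%:R * mdist (z iq.1) x) m) n%:R s.

Lemma cones_continuous z s n : continuous (cones z s n).
Proof.
elim: s => [|[i q] s IH] x; first exact: cvg_cst.
apply: (@continuous_min _ _ (fun x => ratr q + n%:R * mdist (z i) x) _ x);
  last exact: IH.
apply: cvgD; first exact: cvg_cst.
by apply: cvgM; [exact: cvg_cst|exact: mdist_continuous].
Qed.

Lemma cones_le z s n x iq : iq \in s ->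
  cones z s n x <= ratr iq.2 + n%:R * mdist (z iq.1) x.
Proof.
elim: s => [//|a s IH]; rewrite inE => /predU1P[->|/IH h] /=.
  by rewrite ge_min lexx.
by rewrite ge_min h orbT.
Qed.

Lemma cones_ge z s n x (k : R) : k <= n%:R ->
  (forall iq, iq \in s -> k <= ratr iq.2 + n%:R * mdist (z iq.1) x) ->
  k <= cones z s n x.
Proof.
move=> kn; elim: s => [//|a s IH] h /=; rewrite le_min h ?mem_head//=.
by apply: IH => iq iqs; apply: h; rewrite inE iqs orbT.
Qed.

(** Near the diagonal continuity of [f] suffices; away from it [n%:R * mdist y x] exceeds the
    oscillation [2 * M]. Compactness of the square provides a common [N]. *)
Lemma cone_minorant (f : X -> R) e : continuous f -> 0 < e ->
  exists N : nat, forall n, (N <= n)%N ->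
    forall y x, f x - e <= f y + n%:R * mdist y x.
Proof.
move=> cf e0.
have [_ [M fM]] := continuous_bmeasurable cf.
have cXX : compact [set: X * X] by rewrite -setXTT; exact: compact_setX.
have : \forall n \near \oo, [set: X * X] `<=`
    [set yx | f yx.2 - e <= f yx.1 + n%:R * mdist yx.1 yx.2].
  apply: (iffLR (compact_near_coveringP _) cXX nat \oo
    (fun n yx => f yx.2 - e <= f yx.1 + n%:R * mdist yx.1 yx.2)) => -[y x] _.
  have [<-|yx] := eqVneq y x.
    have e2 : 0 < e / 2 by rewrite divr_gt0.
    have /cvgrPdist_lt/(_ _ e2) hy := cf y.
    exists ([set yx | `|f y - f yx.1| < e / 2 /\ `|f y - f yx.2| < e / 2], setT).
      split; last exact: filterT.
      by exists ([set y' | `|f y - f y'| < e / 2], [set y' | `|f y - f y'| < e / 2]).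
    move=> [[y' x'] n] /= [[]]; rewrite !ltr_distl => /andP[? ?] /andP[? ?] _.
    have : 0 <= n%:R * mdist y' x' by rewrite mulr_ge0// mdist_ge0.
    lra.
  have d0 : 0 < mdist y x by rewrite mdist_gt0.
  (* With a third of the distance, points of the two balls of radius [r] stay at least [r] apart. *)
  pose r := mdist y x / 3.
  have r0 : 0 < r by rewrite divr_gt0.
  exists (ball y r `*` ball x r, [set n | 2 * M / r <= n%:R]).
    split; last exact: nbhs_infty_ger.
    by exists (ball y r, ball x r) => //; split; exact: nbhsx_ballx.
  move=> [[y' x'] n] /= [[]]; rewrite !ballEmdist/= => yy' xx' hn.
  have : r <= mdist y' x'.
    have := metric_triangle y y' x; have := metric_triangle y' x' x.
    rewrite (metric_sym x' x) /r in yy' xx' *; lra.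
  move=> h; have := fM y'; have := fM x'; rewrite !ler_norml.
  move=> /andP[? ?] /andP[? ?].
  have : 2 * M <= n%:R * mdist y' x'.
    rewrite ler_pdivrMr// in hn; rewrite (le_trans hn)// ler_wpM2l//.
  lra.
move=> [N _ h]; exists N => n Nn y x; exact: (h n Nn (y, x)).
Qed.

(** Steep cones with vertices slightly above the graph of [f] stay above [f - e] by [cone_minorant].
    A cone with vertex close to [x] is below [f + e] around [x], and by compactness finitely many
    vertices do so everywhere. *)
Lemma cones_dense (z : nat -> X) (f : X -> R) e :
  (forall (x : X) U, nbhs x U -> exists n, U (z n)) -> continuous f -> 0 < e ->
  exists s n, forall x, `|cones z s n x - f x| <= e.
Proof.
move=> dz cf e0.
have e3 : 0 < e / 3 by rewrite divr_gt0.
have [_ [M fM]] := continuous_bmeasurable cf.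
have [N hN] := cone_minorant cf e3.
(* The slope [n] is also the value at which [cones] truncates its minimum, hence it must dominate
   [f] too. *)
have [n Nn Mn] : exists2 n, (N <= n)%N & M <= n%:R.
  exists (maxn N (Num.trunc M).+1); first exact: leq_maxl.
  by rewrite (le_trans (ltW (truncnS_gt _)))// ler_nat leq_maxr.
have /choice[q hq] : forall i, exists q, f (z i) < ratr q < f (z i) + e / 3.
  move=> i; have : f (z i) < f (z i) + e / 3 by rewrite ltrDl.
  by move=> /rat_in_itvoo[q qi]; exists q; rewrite in_itv in qi.
have : \forall K \near \oo, [set: X] `<=` [set x |
    exists2 i, (i < K)%N & ratr (q i) + n%:R * mdist (z i) x < f x + e].
  apply: (iffLR (compact_near_coveringP _) compactX nat \oo (fun K x =>
    exists2 i, (i < K)%N & ratr (q i) + n%:R * mdist (z i) x < f x + e)) => x _.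
  have cg i : continuous (fun x => ratr (q i) + n%:R * mdist (z i) x - f x).
    move=> y; apply: cvgB; last exact: cf.
    apply: cvgD; first exact: cvg_cst.
    by apply: cvgM; [exact: cvg_cst|exact: mdist_continuous].
  have [i hi] : exists i, ratr (q i) + n%:R * mdist (z i) x - f x < e.
    have ch : continuous (fun y => f y + e / 3 + n%:R * mdist x y).
      move=> y; apply: cvgD.
        by apply: cvgD; [exact: cf|exact: cvg_cst].
      by apply: cvgM; [exact: cvg_cst|exact: mdist_continuous].
    have := cvgr_lt _ (ch x); rewrite mdistxx mulr0 addr0.
    have fe : f x + e / 3 < f x + e by lra.
    move=> /(_ _ _ fe)/dz[i hi]; exists i.
    have /andP[_ ?] := hq i; rewrite metric_sym; lra.
  exists ([set x' | ratr (q i) + n%:R * mdist (z i) x' - f x' < e],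
    [set K | (i < K)%N]).
    by split; [exact: cvgr_lt _ (cg i x) _ hi|exact: nbhs_infty_gt].
  by move=> [x' K] /= [h iK]; exists i => //; rewrite -ltrBlDl.
move=> [K _ /(_ K (leqnn K)) hK].
exists [seq (i, q i) | i <- iota 0 K], n => x.
rewrite ler_distl; apply/andP; split.
  apply: cones_ge.
    by have := fM x; rewrite ler_norml => /andP[_]; lra.
  move=> _ /mapP[i _ ->] /=; have := hN n Nn (z i) x.
  by have /andP[? _] := hq i; lra.
have [//|i iK hi] := hK x; apply: le_trans (ltW hi).
apply: (@cones_le _ _ _ _ (i, q i)); apply/mapP; exists i => //.
by rewrite mem_iota.
Qed.

(** Integrals against the countable dense family of cones determine weak convergence, so [B n]
    controls the first cones up to 1 / (n + 1). *)
Lemma wprobability_first_countable (P : wprobability X R) :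
  first_countable_at P.
Proof.
have [z dz] := dense_seq.
pose g j : X -> R := if unpickle j is Some (s, n) then cones z s n else cst 0.
have cg j : continuous (g j).
  rewrite /g; case: unpickle => [[s n]|]; first exact: cones_continuous.
  by move=> x; exact: cvg_cst.
pose B n := [set Q : wprobability X R | forall j, (j <= n)%N ->
  `|\int[Q]_x g j x - \int[P]_x g j x| < n.+1%:R^-1].
have dB : {homo B : m n / (m <= n)%N >-> n `<=` m}.
  move=> m n mn Q h j jm; rewrite (lt_le_trans (h j (leq_trans jm mn)))//.
  by rewrite lef_pV2 ?posrE// ler_nat.
have FB : ProperFilter (filter_from setT B).
  apply: filter_from_proper; last first.
    by move=> n _; exists P => j _; rewrite subrr normr0.
  apply: filter_from_filter; first by exists 0%N.
  move=> m n _ _; exists (maxn m n) => // Q h.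
  by split; apply: dB h; rewrite ?leq_maxl ?leq_maxr.
(* This convergence is exactly the statement that every neighbourhood of [P] contains some [B n]. *)
have FP : filter_from setT B --> P.
  apply/weak_cvg_compactP => f cf; apply/cvgrPdist_lt => e e0.
  have e4 : 0 < e / 4 by rewrite divr_gt0.
  have [s [n hsn]] := cones_dense dz cf e4.
  pose j := pickle (s, n).
  have gE : g j = cones z s n by rewrite /g /j pickleK.
  exists (maxn j (Num.trunc (e / 4)^-1)) => // Q hQ /=.
  have h1 (Q' : probability X R) : `|\int[Q']_x g j x - \int[Q']_x f x| <= e / 4.
    by apply: bRintegral_dist; [exact: continuous_bmeasurable..|rewrite gE].
  have := h1 Q; have := h1 P; have := hQ j (leq_maxl _ _).
  move=> /lt_trans/(_ _) h2.
  have : `|\int[Q]_x g j x - \int[P]_x g j x| < e / 4.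
    apply: h2; rewrite -[ltRHS]invrK ltf_pV2 ?posrE ?invr_gt0//.
    rewrite (lt_le_trans (truncnS_gt _))// ler_nat ltnS.
    exact: leq_maxr.
  rewrite !ler_distl !ltr_distl => /andP[? ?] /andP[? ?] /andP[? ?].
  by apply/andP; split; lra.
exists B; split => //.
  move=> n.
  have /weak_cvg_compactP h : nbhs P --> P by exact: cvg_id.
  have : nbhs P [set Q : wprobability X R | forall j : 'I_n.+1,
      `|\int[Q]_x g j x - \int[P]_x g j x| < n.+1%:R^-1].
    apply: (@filter_forall _ _ (fun (j : 'I_n.+1) (Q : wprobability X R) =>
      `|\int[Q]_x g j x - \int[P]_x g j x| < n.+1%:R^-1) (nbhs P) (nbhs_filter P)).
    move=> j.
    have /cvgrPdist_lt/(_ n.+1%:R^-1) := h _ (cg j).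
    rewrite invr_gt0 ltr0n => /(_ isT).
    by apply: (@filterS _ (nbhs P) (nbhs_filter P)) => Q /=; rewrite distrC.
  apply: (@filterS _ (nbhs P) (nbhs_filter P)) => Q hQ j jn.
  by rewrite -ltnS in jn; exact: (hQ (Ordinal jn)).
by move=> U /FP[n _ nU]; exists n.
Qed.

End weak_compact.

(** * Mixtures and kernels *)

Section bounded_induction.
Context (R : realType).

(** A bounded function is a uniform limit of combinations of indicators: [t] is [f] carried affinely
    into [0, N], and the number of j < N with j < t(x) differs from t(x) by at most 1. *)
Lemma bmeasurable_ind d (T : measurableType d) (C : (T -> R) -> Prop) :
  (forall B, measurable B -> C \1_B) ->
  (forall k f, bmeasurable f -> C f -> C (fun x => k * f x)) ->
  (forall f g, bmeasurable f -> bmeasurable g -> C f -> C g ->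
    C (fun x => f x + g x)) ->
  (forall f, bmeasurable f -> (forall e, 0 < e -> exists g,
    [/\ bmeasurable g, C g & forall x, `|f x - g x| <= e]) -> C f) ->
  forall f, bmeasurable f -> C f.
Proof.
move=> C1 CZ CD Clim f bf; apply: Clim => // e e0.
have [mf [M fM]] := bf.
have [K K0 fK] : exists2 K : R, 0 < K & forall x, `|f x| <= K.
  exists (`|M| + 1) => [|x]; first by rewrite ltr_wpDl.
  by rewrite (le_trans (fM x))// (le_trans (ler_norm M))// lerDl.
pose N := (Num.trunc (2 * K / e)).+1.
have eN : 2 * K / e < N%:R := truncnS_gt _.
have N0 : 0 < N%:R :> R by rewrite ltr0n.
pose t x := N%:R * ((2 * K)^-1 * (f x + K)).
have t0 x : 0 <= t x.
  have := fK x; rewrite ler_norml => /andP[? ?].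
  by rewrite /t !mulr_ge0// ?invr_ge0; lra.
have tN x : t x <= N%:R.
  have := fK x; rewrite ler_norml => /andP[? ?].
  by rewrite /t ler_piMr ?(ltW N0)// mulrC ler_pdivrMr; lra.
pose B j := [set x | j%:R < t x].
have mB (j : nat) : measurable (B j).
  rewrite /B -[X in measurable X]setTI.
  apply: measurable_fun_ltr => //.
  apply: measurable_funM => //; apply: measurable_funM => //.
  exact: measurable_funD.
have hC n : bmeasurable (fun x => \sum_(j < n) (\1_(B j) x : R)) /\
    C (fun x => \sum_(j < n) (\1_(B j) x : R)).
  elim: n => [|n [IH1 IH2]].
    have -> : (fun x => \sum_(j < 0) (\1_(B j) x : R)) = (fun x => 0 * \1_setT x).
      by apply/funext => x; rewrite big_ord0 mul0r.
    by split; [apply: bmeasurableZ|apply: CZ; [|exact: C1]];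
      exact: bmeasurable_indic.
  have -> : (fun x => \sum_(j < n.+1) (\1_(B j) x : R)) =
      (fun x => \sum_(j < n) \1_(B j) x + \1_(B n) x).
    by apply/funext => x; rewrite big_ord_recr.
  by split; [apply: bmeasurableD => //|apply: CD => //; last exact: C1];
    exact: bmeasurable_indic.
(* The last two implications together say that S is at least the minimum of t(x) and n, the form
   that passes through the induction. *)
have hS x n : let S := \sum_(j < n) (\1_(B j) x : R) in
    [/\ S <= t x + 1, S <= n%:R &
      (t x <= n%:R -> t x <= S) /\ (n%:R <= t x -> n%:R <= S)].
  elim: n => [|n [IH1 IH2 [IH3 IH4]]] /=.
    by rewrite big_ord0; have := t0 x; split; [lra|lra|split => ?; lra].
  rewrite big_ord_recr/= -natr1 indicE.
  have [/set_mem/= h|/negP h] := boolP (x \in B n).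
    have {}h : n%:R < t x := h.
    by rewrite /=; split; [lra|lra|split => ?; have := IH4 (ltW h); lra].
  have {}h : t x <= n%:R.
    by rewrite leNgt; apply/negP => hh; apply: h; rewrite inE.
  by rewrite /=; split; [lra|lra|split => ?; have := IH3 h; lra].
have [bS CS] := hC N.
(* The count carried back by the inverse of [t]: its error 1 becomes [2 * K / N], which is below [e]
   by the choice of [N]. *)
exists (fun x => 2 * K / N%:R * (\sum_(j < N) (\1_(B j) x : R)) + (- K) * \1_setT x).
have bT := @bmeasurable_indic _ T R setT measurableT.
split.
- by apply: bmeasurableD; exact: bmeasurableZ.
- apply: CD; [exact: bmeasurableZ|exact: bmeasurableZ|exact: CZ|].
  by apply: CZ => //; exact: C1.
move=> x; rewrite indicT mulr1.
have [S1 S2 [S3 _]] := hS x N; have {}S3 := S3 (tN x).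
set S := \sum_(j < N) _ in S1 S2 S3 *.
have E (y n s : R) : 0 < n ->
    y - (2 * K / n * s + - K) = 2 * K / n * (n * ((2 * K)^-1 * (y + K)) - s).
  by move=> n0; field; rewrite (gt_eqF K0) (gt_eqF n0).
rewrite /= E// -/(t x) {E}.
rewrite normrM gtr0_norm ?divr_gt0 ?mulr_gt0//.
rewrite -[leRHS]mulr1; apply: ler_pM => //.
- by rewrite divr_ge0// ltW// mulr_gt0.
- by rewrite ler_pdivrMr// -ler_pdivrMl// mulrC ltW.
- by rewrite ler_norml; lra.
Qed.

Lemma bmeasurable_comp d1 d2 (O : measurableType d1) (Z : measurableType d2)
    (phi : O -> Z) (f : Z -> R) :
  measurable_fun setT phi -> bmeasurable f -> bmeasurable (fun w => f (phi w)).
Proof.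
move=> mphi [mf [M fM]]; split; first exact: measurableT_comp.
by exists M => w; exact: fM.
Qed.

(* phi has the law of psi w y where w is drawn from P2 and then y from k w. *)
Lemma mixture_Rintegral d1 d2 d3 d4 (O1 : measurableType d1)
    (O2 : measurableType d2) (Y : measurableType d3) (Z : measurableType d4)
    (P1 : probability O1 R) (P2 : probability O2 R)
    (phi : O1 -> Z) (k : O2 -> probability Y R) (psi : O2 -> Y -> Z) :
  measurable_fun setT phi -> (forall w, measurable_fun setT (psi w)) ->
  (forall B, measurable B ->
    measurable_fun setT (fun w => k w (psi w @^-1` B)) /\
    P1 (phi @^-1` B) = (\int[P2]_w k w (psi w @^-1` B))%E) ->
  forall f : Z -> R, bmeasurable f ->
    bmeasurable (fun w => \int[k w]_y f (psi w y)) /\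
    \int[P1]_w f (phi w) = \int[P2]_w \int[k w]_y f (psi w y).
Proof.
move=> mphi mpsi hB f bf.
have bpsi w (g : Z -> R) : bmeasurable g -> bmeasurable (fun y => g (psi w y)).
  by move=> bg; exact: (bmeasurable_comp (mpsi w) bg).
have bphi (g : Z -> R) : bmeasurable g -> bmeasurable (fun w => g (phi w)).
  by move=> bg; exact: (bmeasurable_comp mphi bg).
suff : measurable_fun setT (fun w => \int[k w]_y f (psi w y)) /\
    \int[P1]_w f (phi w) = \int[P2]_w \int[k w]_y f (psi w y).
  move=> [mf ->]; split => //; split => //.
  have [_ [M fM]] := bf; exists M => w.
  by apply: bRintegral_norm; [exact: bpsi|move=> y; exact: fM].
have bI (g : Z -> R) : bmeasurable g ->
    measurable_fun setT (fun w => \int[k w]_y g (psi w y)) ->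
    bmeasurable (fun w => \int[k w]_y g (psi w y)).
  move=> bg mg; split => //; have [_ [M gM]] := bg; exists M => w.
  by apply: bRintegral_norm; [exact: bpsi|move=> y; exact: gM].
move: f bf; apply: bmeasurable_ind.
- move=> B mB; have [mk Pk] := hB B mB.
  have mpB w : measurable (psi w @^-1` B).
    by rewrite -[_ @^-1` _]setTI; exact: mpsi.
  have mphiB : measurable (phi @^-1` B).
    by rewrite -[_ @^-1` _]setTI; exact: mphi.
  have kE w : \int[k w]_y \1_B (psi w y) = fine (k w (psi w @^-1` B)).
    by rewrite -bRintegral_indic//.
  split.
    rewrite (_ : (fun _ => _) = fine \o (fun w => k w (psi w @^-1` B))); last first.
      by apply/funext => w; rewrite kE.
    exact: measurableT_comp.
  have -> : \int[P1]_w \1_B (phi w) = fine (P1 (phi @^-1` B)).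
    by rewrite -bRintegral_indic//.
  rewrite Pk; congr fine; apply: eq_integral => w _.
  by rewrite kE fineK// fin_num_measure.
- move=> a g bg [mg IH].
  have E w : \int[k w]_y (a * g (psi w y)) = a * \int[k w]_y g (psi w y).
    by rewrite bRintegralZ//; exact: (bpsi _ _ bg).
  have EE : (fun w => \int[k w]_y (a * g (psi w y))) =
      (fun w => a * \int[k w]_y g (psi w y)) by exact/funext.
  split; first by rewrite EE; exact: measurable_funM.
  by rewrite EE (bRintegralZ P2 a (bI _ bg mg)) (bRintegralZ P1 a (bphi _ bg)) IH.
- move=> g g' bg bg' [mg IH] [mg' IH'].
  have EE : (fun w => \int[k w]_y (g (psi w y) + g' (psi w y))) =
      (fun w => \int[k w]_y g (psi w y) + \int[k w]_y g' (psi w y)).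
    apply/funext => w.
    by rewrite bRintegralD//; [exact: (bpsi _ _ bg)|exact: (bpsi _ _ bg')].
  split; first by rewrite EE; exact: measurable_funD.
  rewrite EE (bRintegralD P2 (bI _ bg mg) (bI _ bg' mg')).
  by rewrite (bRintegralD P1 (bphi _ bg) (bphi _ bg')) IH IH'.
- move=> g bg lim.
  have /choice[u hu] : forall n : nat, exists g', [/\ bmeasurable g',
      measurable_fun setT (fun w => \int[k w]_y g' (psi w y)) /\
      \int[P1]_w g' (phi w) = \int[P2]_w \int[k w]_y g' (psi w y) &
      forall x, `|g x - g' x| <= n.+1%:R^-1].
    by move=> n; apply: lim.
  have mI : measurable_fun setT (fun w => \int[k w]_y g (psi w y)).
    apply: (@measurable_fun_cvg _ _ _ _ (fun n w => \int[k w]_y u n (psi w y))).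
      by move=> n; have [_ []] := hu n.
    move=> w _; apply/cvgrPdist_le => e e0.
    exists (Num.trunc e^-1) => // n /= Nn.
    have [bu _ un] := hu n.
    apply: (@le_trans _ _ n.+1%:R^-1).
      by apply: bRintegral_dist => //; [exact: (bpsi _ _ bg)|exact: (bpsi _ _ bu)].
    rewrite -[leRHS]invrK lef_pV2 ?posrE ?invr_gt0//.
    by rewrite (le_trans (ltW (truncnS_gt _)))// ler_nat ltnS.
  split => //; apply/eqP; rewrite -subr_eq0 -normr_le0; apply/ler_addgt0Pl => e e0.
  rewrite addr0; have e2 : 0 < e / 2 by rewrite divr_gt0.
  have [g' [bg' [mg' IH] gg']] := lim _ e2.
  have h1 : `|\int[P1]_w g (phi w) - \int[P1]_w g' (phi w)| <= e / 2.
    by apply: bRintegral_dist;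
      [exact: (bphi _ bg)|exact: (bphi _ bg')|move=> w; exact: gg'].
  have h2 : `|\int[P2]_w \int[k w]_y g (psi w y) -
              \int[P2]_w \int[k w]_y g' (psi w y)| <= e / 2.
    apply: bRintegral_dist; [exact: (bI _ bg mI)|exact: (bI _ bg' mg')|move=> w].
    by apply: bRintegral_dist;
      [exact: (bpsi _ _ bg)|exact: (bpsi _ _ bg')|move=> y; exact: gg'].
  move: h1 h2; rewrite IH !ler_norml => /andP[? ?] /andP[? ?].
  by apply/andP; split; lra.
Qed.

End bounded_induction.

Section kernel_law.
Context d d' (X : measurableType d) (Y : measurableType d') (R : realType).
Variables (k : R.-pker X ~> Y) (x : X).

(** By its type [k x] is only a measure; this copy carries the probability structure required by the
    integration lemmas. *)
Definition kernel_law : set Y -> \bar R := k x.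

HB.instance Definition _ := isMeasure.Build _ Y R kernel_law
  (measure0 (k x)) (measure_ge0 (k x)) (@measure_semi_sigma_additive _ _ _ (k x)).

Let kernel_law_setT : kernel_law setT = 1%E.
Proof. exact: prob_kernel. Qed.

HB.instance Definition _ :=
  Measure_isProbability.Build _ _ _ kernel_law kernel_law_setT.

Lemma integral_kernel_law f :
  (\int[kernel_law]_y f y = \int[k x]_y f y)%E.
Proof. exact: eq_measure_integral. Qed.

End kernel_law.

Section joint_law_integral.
Context d d' (X : measurableType d) (Y : measurableType d') (R : realType).
Variables (k : R.-pker X ~> Y) (mu : probability X R).

Lemma measurable_kernel_law_pair (B : set (X * Y)) : measurable B ->
  measurable_fun setT (fun x => kernel_law k x (pair x @^-1` B)).
Proof.
move=> mB; rewrite (_ : (fun _ => _) = (fun x => k x (xsection B x))).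
  by apply: measurable_fun_xsection_finite_kernel; rewrite inE.
by apply/funext => x; rewrite xsectionE.
Qed.

Lemma joint_law_Rintegral (f : X * Y -> R) : bmeasurable f ->
  bmeasurable (fun x => \int[kernel_law k x]_y f (x, y)) /\
  \int[joint_law k mu]_z f z = \int[mu]_x \int[kernel_law k x]_y f (x, y).
Proof.
move=> bf; apply: (@mixture_Rintegral _ _ _ _ _ _ _ _ _ _ mu idfun
  (kernel_law k : X -> probability Y R) pair) bf.
- exact: measurable_id.
- by move=> x; exact: pair1_measurable.
move=> B mB; split; first exact: measurable_kernel_law_pair.
rewrite /= /joint_law; apply: eq_integral => x _.
by rewrite xsectionE.
Qed.

End joint_law_integral.

(** * Laws of controlled processes *)

Section mfun_of_measurable.
Context d1 d2 (O : measurableType d1) (Y : measurableType d2).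
Variables (f : O -> Y) (mf : measurable_fun setT f).

(** The measurability proof is an argument, so that the structure can be inferred from the term. *)
Definition mfun_of of measurable_fun setT f : O -> Y := f.

HB.instance Definition _ := isMeasurableFun.Build _ _ _ _ (mfun_of mf) mf.

End mfun_of_measurable.

Section kernel_of_family.
Context d1 d2 (O : measurableType d1) (Y : measurableType d2) (R : realType).
Variable k : O -> probability Y R.
Hypothesis mk : forall B, measurable B -> measurable_fun setT (fun w => k w B).

(** The same device for kernels. *)
Definition kernel_of of (forall B, measurable B ->
  measurable_fun setT (fun w => k w B)) : O -> {measure set Y -> \bar R} := k.

HB.instance Definition _ := isKernel.Build _ _ _ _ _ (kernel_of mk) mk.

HB.instance Definition _ := Kernel_isProbability.Build _ _ _ _ _
  (kernel_of mk) (fun w => probability_setT (k w)).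

End kernel_of_family.

Section same_law.
Context d1 d2 (O : measurableType d1) (Z : measurableType d2) (R : realType).

(** A degenerate mixture: [psi z] ignores the inner variable, so the inner law can be any
    probability on [Z], and [m] itself is taken. *)
Lemma Rintegral_law (P : probability O R) (m : probability Z R) (phi : O -> Z) :
  measurable_fun setT phi ->
  (forall B, measurable B -> P (phi @^-1` B) = m B) ->
  forall f : Z -> R, bmeasurable f -> \int[P]_w f (phi w) = \int[m]_z f z.
Proof.
move=> mphi hB f bf.
have mE B : (fun z => m ((fun _ : Z => z) @^-1` B)) = (fun z => (\1_B z)%:E).
  apply/funext => z; rewrite preimage_cst indicE; case: ifPn => _.
    exact: probability_setT.
  exact: measure0.
have mpsi (z : Z) : measurable_fun setT ((fun _ => z) : Z -> Z).
  exact: measurable_cst.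
have hk B : measurable B ->
    measurable_fun setT (fun z => m ((fun _ : Z => z) @^-1` B)) /\
    P (phi @^-1` B) = (\int[m]_z m ((fun _ : Z => z) @^-1` B))%E.
  move=> mB; rewrite mE; split; last by rewrite integral_indic// setIT hB.
  by apply/measurable_EFinP; exact: measurable_indic.
have [_ ->] := mixture_Rintegral mphi mpsi hk bf.
by apply: eq_Rintegral => z _; exact: (bRintegral_cst m (f z)).
Qed.

End same_law.

Section transition_mass.
Context (R : realType) d d' (X : borelMetricType R d) (A : borelType d').
Variables (p : X -> A -> wprobability X R -> wprobability X R).
Hypothesis measurable_p : forall mu B, measurable B ->
  measurable_fun setT (fun xa : X * A => p xa.1 xa.2 mu B).

Lemma transition_mass_bmeasurable m B : measurable B ->
  bmeasurable (fun xa : X * A => fine (p xa.1 xa.2 m B)).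
Proof.
move=> mB; apply: (@bmeasurableW _ _ _ _ 1).
  by apply: measurableT_comp => //; exact: measurable_p.
move=> xa; rewrite ger0_norm; last by apply: fine_ge0; exact: measure_ge0.
rewrite -lee_fin fineK ?fin_num_measure//; exact: probability_le1.
Qed.

Lemma EFin_transition_mass x a m B : measurable B ->
  (fine (p x a m B))%:E = p x a m B.
Proof. by move=> mB; rewrite fineK ?fin_num_measure. Qed.

Lemma joint_law_transition (k : R.-pker X ~> A) (m : probability X R) m' B :
  measurable B -> (\int[joint_law k m]_z p z.1 z.2 m' B =
    \int[m]_x \int[k x]_a p x a m' B)%E.
Proof.
move=> mB; have bp := transition_mass_bmeasurable m' mB.
transitivity (\int[joint_law k m]_z fine (p z.1 z.2 m' B))%:E.
  rewrite EFin_Rintegral//; apply: eq_integral => z _.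
  by rewrite EFin_transition_mass.
have [bI ->] := joint_law_Rintegral k m bp.
rewrite EFin_Rintegral//; apply: eq_integral => x _.
rewrite EFin_Rintegral; last exact: (bmeasurable_comp (pair1_measurable x) bp).
rewrite integral_kernel_law; apply: eq_integral => b _.
by rewrite EFin_transition_mass.
Qed.

End transition_mass.

Section process_laws.
Context (R : realType) d d' (X : borelMetricType R d) (A : borelType d').
Variables (p : X -> A -> wprobability X R -> wprobability X R).
Hypothesis measurable_p : forall mu B, measurable B ->
  measurable_fun setT (fun xa : X * A => p xa.1 xa.2 mu B).
Variables (mu0 : probability X R) (h : option nat).
Variables (pi : nat -> R.-pker X ~> A) (mu : nat -> wprobability X R).
Context d0 (O : measurableType d0) (P : probability O R).
Variables (x : nat -> {RV P >-> X}) (a : nat -> {RV P >-> A}).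
Hypothesis proc : controlled_process p mu0 h pi mu x a.

Lemma measurable_state_action t : measurable_fun setT (fun w => (x t w, a t w)).
Proof. exact: measurable_fun_pair. Qed.

Lemma history_state n m t B : (t < n)%N -> measurable B ->
  history x a n m (x t @^-1` B).
Proof. by move=> tn mB; apply: sub_sigma_algebra; left; exists t, B. Qed.

(** On a rectangle this is [action_law] for an event about the current state only. Both sides are
    measures in [B], and rectangles form a generating pi-system. *)
Lemma state_action_law t B : stage h t -> measurable B ->
  P ((fun w => (x t w, a t w)) @^-1` B) =
  (\int[P]_w kernel_law (pi t) (x t w) (pair (x t w) @^-1` B))%E.
Proof.
move=> ht mB.
have mxa := measurable_state_action t.
pose D : probability X R := distribution P (x t).
have DE (f : X -> \bar R) : measurable_fun setT f -> (forall y, 0 <= f y)%E ->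
    (\int[D]_y f y = \int[P]_w f (x t w))%E.
  by move=> mf f0; exact: ge0_integral_distribution.
transitivity (joint_law (pi t) D B); last first.
  rewrite /joint_law DE//.
    by apply: eq_integral => w _ /=; rewrite xsectionE.
  by apply: measurable_fun_xsection_finite_kernel; rewrite inE.
rewrite -[LHS]/(pushforward P (fun w => (x t w, a t w)) B).
apply: (@measure_unique _ R (X * A)%type
  [set S `*` T | S in measurable & T in measurable] (fun=> setT)) => //.
- exact: measurable_prod_measurableType.
- move=> _ _ [S mS [T mT <-]] [S' mS' [T' mT' <-]].
  exists (S `&` S'); first exact: measurableI.
  by exists (T `&` T'); [exact: measurableI|rewrite setXI].
- by move=> _; exists setT => //; exists setT => //; rewrite setXTT.
- by rewrite bigcup_const.
- move=> _ [S mS [T mT <-]].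
  transitivity (P (x t @^-1` S `&` a t @^-1` T)).
    by congr (P _); apply/seteqP; split => w.
  rewrite (action_law proc ht)//; last exact: history_state.
  rewrite -[RHS]/(joint_law (pi t) D (S `*` T)) /joint_law DE//; last first.
    by apply: measurable_fun_xsection_finite_kernel; rewrite inE; exact: measurableX.
  rewrite integral_mkcond; apply: eq_integral => w _ /=.
  rewrite patchE; case: ifPn => [/set_mem Sw|/negP Sw].
    by rewrite in_xsectionX// inE.
  rewrite notin_xsectionX ?measure0//.
  by apply/negP => /set_mem Sxw; apply: Sw; rewrite inE.
- move=> _; apply: le_lt_trans (ltry 1).
  exact: (probability_le1 (distribution P (mfun_of mxa))).
Qed.

Lemma action_Rintegral t (f : X * A -> R) : stage h t -> bmeasurable f ->
  \int[P]_w f (x t w, a t w) =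
  \int[P]_w \int[kernel_law (pi t) (x t w)]_b f (x t w, b).
Proof.
move=> ht bf.
have [] := @mixture_Rintegral R _ _ _ _ O O A (X * A)%type P P
  (fun w => (x t w, a t w)) (fun w => kernel_law (pi t) (x t w))
  (fun w b => (x t w, b)) _ _ _ f bf => //.
- exact: measurable_state_action.
- by move=> w; exact: pair1_measurable.
- move=> B mB; split; last exact: state_action_law.
  exact: (measurableT_comp (measurable_kernel_law_pair (pi t) mB)).
Qed.

Lemma measurable_transition t B : measurable B ->
  measurable_fun setT (fun w => p (x t w) (a t w) (mu t) B).
Proof.
move=> mB.
exact: (measurableT_comp (measurable_p (mu t) mB) (measurable_state_action t)).
Qed.

Lemma state_law t B : stage h t.+1 -> measurable B ->
  P (x t.+1 @^-1` B) = (\int[P]_w p (x t w) (a t w) (mu t) B)%E.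
Proof.
move=> ht mB; transitivity (P (x 0%N @^-1` setT `&` x t.+1 @^-1` B)).
  by rewrite preimage_setT setTI.
rewrite (transition_law proc ht)//; last exact: history_state.
Qed.

Lemma transition_Rintegral t (g : X -> R) : stage h t.+1 -> bmeasurable g ->
  bmeasurable (fun w => \int[p (x t w) (a t w) (mu t)]_y g y) /\
  \int[P]_w g (x t.+1 w) = \int[P]_w \int[p (x t w) (a t w) (mu t)]_y g y.
Proof.
move=> ht bg.
have [] := @mixture_Rintegral R _ _ _ _ O O X X P P
  (x t.+1) (fun w => p (x t w) (a t w) (mu t)) (fun w y => y) _ _ _ g bg => //.
move=> B mB; split; first exact: measurable_transition.
  exact: state_law.
Qed.

Lemma stageW t : stage h t.+1 -> stage h t.
Proof. by rewrite /stage; case: h => // T; exact: ltnW. Qed.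

Hypothesis mu_initial : forall B, measurable B -> mu 0%N B = mu0 B.
Hypothesis mu_flow : forall t, stage h t.+1 -> forall B, measurable B ->
  mu t.+1 B = (\int[mu t]_y \int[pi t y]_b p y b (mu t) B)%E.

(** By induction the pair at stage t has law [joint_law (pi t) (mu t)], and the flow equation then
    gives the law of the next state. Thus the cost of the policy that generates the flow can be read
    off the joint laws; a deviating player has other state laws and is treated through value
    functions. *)
Lemma state_marginal t B : stage h t -> measurable B ->
  P (x t @^-1` B) = mu t B.
Proof.
elim: t B => [|t IH] B ht mB.
  by rewrite mu_initial// (initial_law proc).
rewrite state_law// mu_flow// -(joint_law_transition measurable_p)//.
have bp := transition_mass_bmeasurable measurable_p (mu t) mB.
transitivity (\int[P]_w fine (p (x t w) (a t w) (mu t) B))%:E.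
  rewrite EFin_Rintegral; last first.
    exact: (bmeasurable_comp (measurable_state_action t) bp).
  by apply: eq_integral => w _; rewrite EFin_transition_mass.
rewrite (action_Rintegral (stageW ht) bp).
have [bI E] := joint_law_Rintegral (pi t) (mu t) bp.
transitivity (\int[joint_law (pi t) (mu t)]_z fine (p z.1 z.2 (mu t) B))%:E.
  rewrite E; congr EFin.
  exact: (Rintegral_law _ (fun B mB => IH B (stageW ht) mB) bI).
rewrite EFin_Rintegral//; apply: eq_integral => z _.
by rewrite EFin_transition_mass.
Qed.

Lemma state_action_Rintegral t (f : X * A -> R) : stage h t -> bmeasurable f ->
  \int[P]_w f (x t w, a t w) = \int[joint_law (pi t) (mu t)]_z f z.
Proof.
move=> ht bf.
have [bI ->] := @joint_law_Rintegral _ _ _ _ _ (pi t) (mu t) _ bf.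
rewrite (action_Rintegral ht bf).
exact: (Rintegral_law _ (fun B mB => state_marginal ht mB) bI).
Qed.

End process_laws.

(** * Existence of controlled processes *)

Section extension.
Local Open Scope ereal_scope.
Context (R : realType) d1 d2 (O : measurableType d1) (Y : measurableType d2).
Variables (P : probability O R) (k : R.-pker O ~> Y).

Lemma joint_law_setX (H : set O) (C : set Y) : measurable H -> measurable C ->
  joint_law k P (fst @^-1` H `&` snd @^-1` C) = \int[P]_(w in H) k w C.
Proof.
move=> mH mC; rewrite /joint_law [RHS]integral_mkcond.
apply: eq_integral => w _.
have -> : fst @^-1` H `&` snd @^-1` C = H `*` C by [].
rewrite patchE; case: ifPn => Hw; first by rewrite in_xsectionX.
by rewrite notin_xsectionX// measure0.
Qed.

Lemma joint_law_fst (H : set O) : measurable H ->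
  joint_law k P (fst @^-1` H) = P H.
Proof.
move=> mH; rewrite -[X in joint_law _ _ X]setIT -[setT](preimage_setT snd).
rewrite joint_law_setX// (eq_integral (cst 1)); last first.
  by move=> w _; exact: prob_kernel.
by rewrite integral_cst// mul1e.
Qed.

Lemma joint_law_integral_fst (H : set O) (g : O -> \bar R) : measurable H ->
  measurable_fun setT g -> (forall w, 0 <= g w) ->
  \int[joint_law k P]_(z in fst @^-1` H) g z.1 = \int[P]_(w in H) g w.
Proof.
move=> mH mg g0.
have mf : measurable_fun setT (fst : O * Y -> O) by exact: measurable_fst.
have -> : \int[P]_(w in H) g w = \int[pushforward (joint_law k P) fst]_(w in H) g w.
  apply: eq_measure_integral => B mB _.
  by rewrite -[RHS]/(joint_law k P (fst @^-1` B)) joint_law_fst.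
rewrite ge0_integral_pushforward//.
exact: measurable_funTS.
Qed.

End extension.

Section history_lift.
Context (d0 d1 d d' : measure_display) (O : measurableType d0) (O' : measurableType d1).
Context (X : measurableType d) (A : measurableType d').

(** The pullbacks of events of the original history form a sigma-algebra, and it contains the
    generators of the lifted history. *)
Lemma history_lift (f : O' -> O) (x : nat -> O -> X) (a : nat -> O -> A)
    (x' : nat -> O' -> X) (a' : nat -> O' -> A) n m H :
  (forall s, (s < n)%N -> x' s = x s \o f) ->
  (forall s, (s < m)%N -> a' s = a s \o f) ->
  history x' a' n m H -> exists2 H0, history x a n m H0 & H = f @^-1` H0.
Proof.
move=> xE aE.
pose G := [set H : set O' | exists2 H0, history x a n m H0 & H = f @^-1` H0].
suff : history x' a' n m `<=` G by exact.
apply: smallest_sub; last first.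
  move=> _ [] [s [B [sn mB ->]]].
    exists (x s @^-1` B); last by rewrite xE.
    by apply: sub_sigma_algebra; left; exists s, B.
  exists (a s @^-1` B); last by rewrite aE.
  by apply: sub_sigma_algebra; right; exists s, B.
have [h0 hC hU] : sigma_algebra setT (history x a n m).
  exact: smallest_sigma_algebra.
split.
- by exists set0; rewrite ?preimage_set0.
- move=> _ [H0 hH ->]; exists (setT `\` H0); first exact: hC.
  by rewrite !setTD preimage_setC.
- move=> F hF.
  have /choice[F0 hF0] : forall i, exists H0, history x a n m H0 /\ F i = f @^-1` H0.
    by move=> i; have [H0 ? ?] := hF i; exists H0.
  exists (\bigcup_i F0 i); first by apply: hU => i; have [] := hF0 i.
  by rewrite preimage_bigcup; apply: eq_bigcupr => i _; have [] := hF0 i.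
Qed.

Lemma history_measurable (x : nat -> O -> X) (a : nat -> O -> A) n m H :
  (forall s, measurable_fun setT (x s)) -> (forall s, measurable_fun setT (a s)) ->
  history x a n m H -> measurable H.
Proof.
move=> mx ma; suff : history x a n m `<=` measurable by exact.
apply: smallest_sub; first exact: sigma_algebra_measurable.
move=> _ [] [s [B [_ mB ->]]]; rewrite -[_ @^-1` _]setTI; [exact: mx|exact: ma].
Qed.

End history_lift.

Section existence.
Context (R : realType) d d' (X : borelMetricType R d) (A : borelType d').
Variables (p : X -> A -> wprobability X R -> wprobability X R).
Hypothesis measurable_p : forall mu B, measurable B ->
  measurable_fun setT (fun xa : X * A => p xa.1 xa.2 mu B).
Variables (mu0 : probability X R).
Variables (pi : nat -> R.-pker X ~> A) (mu : nat -> wprobability X R).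

(* A process of which the first n states and m actions have the required laws. *)
Record partial_process n m d0 (O : measurableType d0) (P : probability O R)
    (x : nat -> {RV P >-> X}) (a : nat -> {RV P >-> A}) : Prop := {
  partial_initial : forall B, measurable B -> P (x 0%N @^-1` B) = mu0 B ;
  partial_action : forall t, (t < m)%N -> forall H C,
    history x a t.+1 t H -> measurable C ->
    P (H `&` a t @^-1` C) = (\int[P]_(w in H) pi t (x t w) C)%E ;
  partial_transition : forall t, (t.+1 < n)%N -> forall H B,
    history x a t.+1 t.+1 H -> measurable B ->
    P (H `&` x t.+1 @^-1` B) = (\int[P]_(w in H) p (x t w) (a t w) (mu t) B)%E }.

(** All events about the first n states and m actions are pulled back along [fst], and
    [joint_law k P] has first marginal [P]. The constraints between n and m keep every index that
    occurs within these ranges. *)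
Lemma partial_process_lift n m d1 d2 (O : measurableType d1)
    (Y : measurableType d2) (P : probability O R) (k : R.-pker O ~> Y)
    (x : nat -> {RV P >-> X}) (a : nat -> {RV P >-> A})
    (x' : nat -> {RV (joint_law k P) >-> X}) (a' : nat -> {RV (joint_law k P) >-> A}) :
  (0 < n)%N -> (m <= n)%N -> (n <= m.+1)%N ->
  (forall s, (s < n)%N -> x' s = x s \o fst :> (_ -> _)) ->
  (forall s, (s < m)%N -> a' s = a s \o fst :> (_ -> _)) ->
  partial_process n m x a -> partial_process n m x' a'.
Proof.
move=> n0 mn nm xE aE [init act trans].
have mH n' m' H0 : history x a n' m' H0 -> measurable H0.
  by apply: history_measurable => s.
split.
- move=> B mB; rewrite xE// comp_preimage.
  rewrite -[LHS]/(joint_law k P (fst @^-1` (x 0%N @^-1` B))) joint_law_fst//.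
    exact: init.
  by rewrite -[_ @^-1` _]setTI; exact: measurable_funPT.
- move=> t tm H C hH mC.
  have [H0 hH0 ->] : exists2 H0, history x a t.+1 t H0 & H = fst @^-1` H0.
    apply: (@history_lift _ _ _ _ O (O * Y)%type X A fst x a x' a' _ _ H _ _ hH);
      move=> s sn; first by rewrite xE// (leq_trans sn)// (leq_trans tm).
    by rewrite aE// (ltn_trans sn).
  have mH0 := mH _ _ _ hH0.
  rewrite aE// comp_preimage -preimage_setI.
  have maC : measurable (a t @^-1` C).
    by rewrite -[_ @^-1` _]setTI; exact: measurable_funPT.
  rewrite -[LHS]/(joint_law k P _) joint_law_fst; last exact: measurableI.
  rewrite act// xE; last exact: leq_trans tm mn.
  rewrite -(@joint_law_integral_fst _ _ _ _ _ P k H0 (fun w => pi t (x t w) C))//.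
  exact: (measurableT_comp (measurable_kernel (pi t) C mC)).
- move=> t tn H B hH mB.
  have tm : (t < m)%N by rewrite -ltnS (leq_trans tn).
  have [H0 hH0 ->] : exists2 H0, history x a t.+1 t.+1 H0 & H = fst @^-1` H0.
    apply: (@history_lift _ _ _ _ O (O * Y)%type X A fst x a x' a' _ _ H _ _ hH);
      move=> s sn; first by rewrite xE// (ltn_trans sn).
    by rewrite aE// (leq_trans sn).
  have mH0 := mH _ _ _ hH0.
  rewrite xE// comp_preimage -preimage_setI.
  have mxB : measurable (x t.+1 @^-1` B).
    by rewrite -[_ @^-1` _]setTI; exact: measurable_funPT.
  rewrite -[LHS]/(joint_law k P _) joint_law_fst; last exact: measurableI.
  rewrite trans// xE; last exact: ltn_trans tn.
  rewrite aE//.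
  rewrite -(@joint_law_integral_fst _ _ _ _ _ P k H0
    (fun w => p (x t w) (a t w) (mu t) B))//.
  exact: (measurable_transition measurable_p mu x a _ mB).
Qed.

Let exists_partial n m := exists d0 (O : measurableType d0) (P : probability O R)
  (x : nat -> {RV P >-> X}) (a : nat -> {RV P >-> A}), partial_process n m x a.

Let exists_partial_action n : exists_partial n.+1 n -> exists_partial n.+1 n.+1.
Proof.
move=> [d0 [] O [] P [] x [] a pp].
pose kf (w : O) : probability A R := kernel_law (pi n) (x n w).
have mk B : measurable B -> measurable_fun setT (fun w => kf w B).
  by move=> mB; exact: (measurableT_comp (measurable_kernel (pi n) B mB)).
pose k : R.-pker O ~> A := kernel_of mk.
exists _, (O * A)%type, (joint_law k P : probability _ R).
have mx s : measurable_fun setT (x s \o (@fst O A)) by exact: measurableT_comp.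
have ma s : measurable_fun setT
    (if s == n then @snd O A else a s \o (@fst O A)).
  by case: ifPn => _; [exact: measurable_snd|exact: measurableT_comp].
exists (fun s => mfun_of (mx s)), (fun s => mfun_of (ma s)).
have [init act trans] : partial_process n.+1 n (P := joint_law k P)
    (fun s => mfun_of (mx s)) (fun s => mfun_of (ma s)).
  apply: (partial_process_lift _ _ _ _ _ pp) => //.
  by move=> s sn; rewrite /= /mfun_of ltn_eqF.
split => // t; rewrite ltnS leq_eqVlt => /predU1P[->|]; last exact: act.
move=> H C hH mC.
have [H0 hH0 ->] : exists2 H0, history x a n.+1 n H0 & H = fst @^-1` H0.
  apply: (history_lift (x := fun s => x s) (a := fun s => a s) _ _ hH) => s sn //.
  by rewrite /= /mfun_of ltn_eqF.
have mH0 : measurable H0 by apply: history_measurable hH0 => s.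
have -> : mfun_of (ma n) @^-1` C = snd @^-1` C by rewrite /mfun_of eqxx.
rewrite -[LHS]/(joint_law k P _) joint_law_setX//.
rewrite -(@joint_law_integral_fst _ _ _ _ _ P k H0 (fun w => k w C))//.
exact: (mk C mC).
Qed.

Let exists_partial_transition n :
  exists_partial n.+1 n.+1 -> exists_partial n.+2 n.+1.
Proof.
move=> [d0 [] O [] P [] x [] a pp].
pose kf (w : O) : probability X R := p (x n w) (a n w) (mu n).
have mk B : measurable B -> measurable_fun setT (fun w => kf w B).
  by move=> mB; exact: (measurable_transition measurable_p mu x a _ mB).
pose k : R.-pker O ~> X := kernel_of mk.
exists _, (O * X)%type, (joint_law k P : probability _ R).
have ma s : measurable_fun setT (a s \o (@fst O X)) by exact: measurableT_comp.
have mx s : measurable_fun setT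
    (if s == n.+1 then @snd O X else x s \o (@fst O X)).
  by case: ifPn => _; [exact: measurable_snd|exact: measurableT_comp].
exists (fun s => mfun_of (mx s)), (fun s => mfun_of (ma s)).
have [init act trans] : partial_process n.+1 n.+1 (P := joint_law k P)
    (fun s => mfun_of (mx s)) (fun s => mfun_of (ma s)).
  apply: (partial_process_lift _ _ _ _ _ pp) => //.
  by move=> s sn; rewrite /= /mfun_of ltn_eqF.
split => // t; rewrite ltnS leq_eqVlt => /predU1P[[->]|]; last exact: trans.
move=> H B hH mB.
have [H0 hH0 ->] : exists2 H0, history x a n.+1 n.+1 H0 & H = fst @^-1` H0.
  apply: (history_lift (x := fun s => x s) (a := fun s => a s) _ _ hH) => s sn //.
  by rewrite /= /mfun_of ltn_eqF.
have mH0 : measurable H0 by apply: history_measurable hH0 => s.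
have -> : mfun_of (mx n.+1) @^-1` B = snd @^-1` B by rewrite /mfun_of eqxx.
rewrite -[LHS]/(joint_law k P _) joint_law_setX//.
rewrite -(@joint_law_integral_fst _ _ _ _ _ P k H0 (fun w => k w B))//.
  congr (integral _ _ _); apply: funext => z.
  rewrite -[LHS]/(p (x n z.1) (a n z.1) (mu n) B).
  congr (Probability.sort (p _ _ _) _).
  by rewrite /= /mfun_of ltn_eqF.
exact: (mk B mB).
Qed.

Lemma exists_process T : exists d0 (O : measurableType d0) (P : probability O R)
  (x : nat -> {RV P >-> X}) (a : nat -> {RV P >-> A}),
  controlled_process p mu0 (Some T) pi mu x a.
Proof.
(* One stage beyond the horizon, because even for [T = 0] an initial state is required. *)
suff [d0 [] O [] P [] x [] a [init act trans]] : exists_partial T.+1 T.+1.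
  exists d0, O, P, x, a; split => // t /=.
    by move=> tT; exact: act (ltnW tT).
  by move=> tT; exact: trans (ltnW tT).
apply: exists_partial_action.
elim: T => [|T /exists_partial_action]; last exact: exists_partial_transition.
exists d, X, mu0, (fun=> mfun_of (@measurable_id _ X setT)),
  (fun=> mfun_of (@measurable_cst _ _ X A setT point)).
by split.
Qed.

End existence.

(** * Value functions *)

Lemma fst_continuous (T U : topologicalType) : continuous (@fst T U).
Proof. by case=> t u; exact: cvg_fst. Qed.

Lemma snd_continuous (T U : topologicalType) : continuous (@snd T U).
Proof. by case=> t u; exact: cvg_snd. Qed.

Lemma continuous_pair (T U V : topologicalType) (f : T -> U) (g : T -> V) t :
  {for t, continuous f} -> {for t, continuous g} ->
  {for t, continuous (fun t => (f t, g t))}.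
Proof. by move=> cf cg; exact: cvg_pair. Qed.

Lemma continuous_section1 (T U V : topologicalType) (f : T * U -> V) (t : T) :
  continuous f -> continuous (fun u => f (t, u)).
Proof.
move=> cf u; apply: (@continuous_comp _ _ _ (pair t) f); last exact: cf.
by apply: cvg_pair; [exact: cvg_cst|exact: cvg_id].
Qed.

Lemma continuous_section2 (T U V : topologicalType) (f : T * U -> V) (u : U) :
  continuous f -> continuous (fun t => f (t, u)).
Proof.
move=> cf t; apply: (@continuous_comp _ _ _ (pair^~ u) f); last exact: cf.
by apply: cvg_pair; [exact: cvg_id|exact: cvg_cst].
Qed.

Lemma Rintegral_continuous (R : realType) d (X : borelMetricType R d) (f : X -> R) :
  compact [set: X] -> continuous f ->
  continuous (fun Q : wprobability X R => \int[Q]_x f x).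
Proof.
move=> cX cf Q.
exact: (iffLR (weak_cvg_compactP cX Q (nbhs_filter Q)) (@cvg_id _ (nbhs Q)) f cf).
Qed.

Section infimum.
Context (R : realType) (T : pointedType).
Implicit Types f g : T -> R.

Let range0 f : range f !=set0.
Proof. by exists (f point), point. Qed.

Lemma inf_range_le f t : has_lbound (range f) -> inf (range f) <= f t.
Proof. by move=> lf; apply: ge_inf => //; exists t. Qed.

Lemma inf_range_approx f e : has_lbound (range f) -> 0 < e ->
  exists t, f t < inf (range f) + e.
Proof.
move=> lf e0; have [_ [t _ <-] h] := inf_adherent e0 (conj (range0 f) lf).
by exists t.
Qed.

Lemma inf_range_dist f g e : has_lbound (range f) -> has_lbound (range g) ->
  (forall t, `|f t - g t| <= e) -> `|inf (range f) - inf (range g)| <= e.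
Proof.
move=> lf lg fg; rewrite ler_distl; apply/andP; split.
  apply: lb_le_inf => // _ [t _ <-]; rewrite lerBlDr.
  apply: le_trans (inf_range_le t lg) _.
  by have := fg t; rewrite ler_distl => /andP[]; lra.
rewrite -lerBlDr; apply: lb_le_inf => // _ [t _ <-]; rewrite lerBlDr.
apply: le_trans (inf_range_le t lf) _.
by have := fg t; rewrite ler_distl => /andP[]; lra.
Qed.

End infimum.

(** * Measurable choice of almost minimizing actions *)

Section selector.
Context (R : realType) d d' (X : borelMetricType R d) (A : borelType d').
Variable bA : nat -> set A.
Hypothesis basisA : basis_seq bA.
Hypothesis compactA : compact [set: A].

Lemma continuous_has_lbound (f : A -> R) : continuous f -> has_lbound (range f).
Proof.
move=> cf; have [M fM] : exists M, forall a, `|f a| <= M.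
  by apply/bounded_fun_normP; exact: compact_bounded_fun.
by exists (- M) => _ [a _ <-]; have := fM a; rewrite ler_norml => /andP[].
Qed.

(** The selector is the first point of a countable dense sequence that meets the strict bound; one
    exists by continuity in the action. Having countable range, it is measurable as soon as the sets
    where the index equals n are. *)
Lemma measurable_selector (q : X -> A -> R) (v : X -> R) e : 0 < e ->
  (forall a, measurable_fun setT (q ^~ a)) -> measurable_fun setT v ->
  (forall x, continuous (q x)) ->
  (forall x, exists a, q x a < v x + e) ->
  exists2 s : X -> A, measurable_fun setT s & forall x, q x (s x) < v x + e.
Proof.
move=> e0 mq mv cq qv.
pose z n := xget point (bA n).
have dz x : exists n, q x (z n) < v x + e.
  have [a qa] := qv x; have [obA hbA] := basisA.
  have nq : nbhs a [set b | q x b < v x + e] by exact: (cvgr_lt _ (cq x a) _ qa).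
  have [n [na nb]] := hbA _ _ nq; exists n; apply: nb.
  by apply: xgetPex; exists a.
pose i x := ex_minn (dz x).
exists (z \o i); last by move=> x; rewrite /= /i; case: ex_minnP.
pose L n := [set x | q x (z n) < v x + e].
have mL n : measurable (L n).
  rewrite -[L n]setTI; apply: measurable_fun_ltr => //.
  exact: measurable_funD.
have iE n : [set x | i x = n] = L n `&` ~` \bigcup_(j in `I_n) L j.
  apply/seteqP; split => [x /= <-|x /= [Ln nL]].
    rewrite /i; case: ex_minnP => k Lk mink; split => // -[j /= jk Lj].
    by have := mink _ Lj; rewrite leqNgt jk.
  rewrite /i; case: ex_minnP => k Lk mink; apply/eqP.
  rewrite eqn_leq (mink _ Ln)/= leqNgt; apply/negP => kn.
  by apply: nL; exists k.
have mi n : measurable [set x | i x = n].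
  rewrite iE; apply: measurableI => //; apply: measurableC.
  exact: bigcup_measurable.
move=> _ B mB; rewrite setTI.
have -> : (z \o i) @^-1` B = \bigcup_(n in [set n | B (z n)]) [set x | i x = n].
  apply/seteqP; split => [x Bx|x [n Bn /= ixn]]; first by exists (i x).
  by rewrite /= ixn.
exact: bigcup_measurable.
Qed.

End selector.

(** * Bellman recursion and joint continuity of the values *)

Section value.
Context (R : realType) d d' (X : borelMetricType R d) (A : borelType d').
Variable bA : nat -> set A.
Hypothesis basisA : basis_seq bA.
Hypothesis compactA : compact [set: A].
Hypothesis compactX : compact [set: X].
Variables (beta : R) (c : X -> A -> wprobability X R -> R).
Variables (p : X -> A -> wprobability X R -> wprobability X R).
Hypothesis beta_ge0 : 0 <= beta.
Hypothesis beta_lt1 : beta < 1.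
Hypothesis continuous_cp : forall (x_ : nat -> X) (a_ : nat -> A)
        (mu_ : nat -> wprobability X R) (x : X) (a : A)
        (mu : wprobability X R),
      x_ n @[n --> \oo] --> x -> a_ n @[n --> \oo] --> a ->
      mu_ n @[n --> \oo] --> mu ->
      (c (x_ n) (a_ n) (mu_ n) @[n --> \oo] --> c x a mu) /\
      (p (x_ n) (a_ n) (mu_ n) @[n --> \oo] --> p x a mu).

Let flow := {ptws nat -> wprobability X R}.

Let first_countableX (x : X) : first_countable_at x.
Proof.
have [b hb] := second_countable_seq (compact_second_countable compactX).
exact: basis_first_countable hb.
Qed.

Let seq_pair (T U : topologicalType) (u : nat -> T * U) (z : T * U) :
  u @ \oo --> z -> (u n).1 @[n --> \oo] --> z.1 /\ (u n).2 @[n --> \oo] --> z.2.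
Proof.
case: z => a b uz; split.
  by apply: cvg_comp uz _; exact: cvg_fst.
by apply: cvg_comp uz _; exact: cvg_snd.
Qed.

Let first_countable_point (z : wprobability X R * (X * A)) :
  first_countable_at z.
Proof.
case: z => mu [x a]; apply: prod_first_countable.
  exact: wprobability_first_countable.
apply: prod_first_countable; first exact: first_countableX.
exact: basis_first_countable basisA.
Qed.

Lemma cost_continuous :
  continuous (fun z : wprobability X R * (X * A) => c z.2.1 z.2.2 z.1).
Proof.
move=> z; apply: seq_continuous_at => // u /seq_pair[h1 /seq_pair[h2 h3]].
exact: (continuous_cp h2 h3 h1).1.
Qed.

Lemma transition_continuous :
  continuous (fun z : wprobability X R * (X * A) => p z.2.1 z.2.2 z.1).
Proof.
move=> z; apply: seq_continuous_at => // u /seq_pair[h1 /seq_pair[h2 h3]].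
exact: (continuous_cp h2 h3 h1).2.
Qed.

Lemma transition_integral_continuous (f : X -> R) : continuous f ->
  continuous (fun z : wprobability X R * (X * A) =>
    \int[p z.2.1 z.2.2 z.1]_y f y).
Proof.
move=> cf z.
apply: (@continuous_comp _ _ _
  (fun z : wprobability X R * (X * A) => p z.2.1 z.2.2 z.1)
  (fun Q : wprobability X R => \int[Q]_y f y)).
  exact: transition_continuous.
exact: (Rintegral_continuous compactX cf).
Qed.

Lemma cost_bounded : exists M, forall x a mu, `|c x a mu| <= M.
Proof.
have cPXA : compact [set: wprobability X R * (X * A)].
  rewrite -setXTT; apply: compact_setX; first exact: wprobability_compact.
  by rewrite -setXTT; exact: compact_setX.
have /bounded_fun_normP[M hM] := compact_bounded_fun cPXA cost_continuous.
by exists M => x a mu; exact: (hM (mu, (x, a))).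
Qed.

Lemma measurable_transition_kernel mu B : measurable B ->
  measurable_fun setT (fun xa : X * A => p xa.1 xa.2 mu B).
Proof.
have [bX hX] := second_countable_seq (compact_second_countable compactX).
move: B; apply: measurable_fun_kernel => f cf _.
apply: (continuous_measurable_prod hX basisA).
exact: (continuous_section1 (transition_integral_continuous cf)).
Qed.

Lemma continuous_bmeasurable_prod (f : X * A -> R) : continuous f -> bmeasurable f.
Proof.
have [bX hX] := second_countable_seq (compact_second_countable compactX).
move=> cf; split; first exact: (continuous_measurable_prod hX basisA).
apply/bounded_fun_normP; apply: compact_bounded_fun => //.
by rewrite -setXTT; exact: compact_setX.
Qed.

Definition shift_flow (mu : flow) : flow := fun t => mu t.+1.

(** Time is advanced by shifting the flow instead of carrying a stage index, so that continuity in
    the pair [(mu, x)] is a self-contained induction hypothesis. *)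
Fixpoint value n (mu : flow) (x : X) : R :=
  if n is n'.+1 then
    inf (range (fun a => c x a (mu 0%N) +
                         beta * \int[p x a (mu 0%N)]_y value n' (shift_flow mu) y))
  else 0.

(** The Q-function: play [a] now, then optimally for [n] stages. *)
Definition action_value n (mu : flow) (x : X) (a : A) : R :=
  c x a (mu 0%N) + beta * \int[p x a (mu 0%N)]_y value n (shift_flow mu) y.

Let eval_continuous t : continuous (fun mu : flow => mu t).
Proof.
move=> mu; have /prod_topology_cvgP : nbhs mu --> mu by exact: cvg_id.
exact.
Qed.

Lemma shift_flow_continuous : continuous shift_flow.
Proof.
move=> mu; apply/(iffRL (@prod_topology_cvgP nat (fun=> wprobability X R)
  (shift_flow @ nbhs mu) (shift_flow mu) (fmap_filter _ _))) => t.
exact: (@eval_continuous t.+1 mu).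
Qed.

Let joint_continuous n :=
  continuous (fun z : flow * X => value n z.1 z.2).

Let value_section n mu : joint_continuous n -> continuous (value n mu).
Proof.
by move=> cn; exact: (continuous_section1 cn).
Qed.

Let value_uniform n (mu : flow) e : joint_continuous n -> 0 < e ->
  \forall mu' \near mu, forall x, `|value n mu' x - value n mu x| < e.
Proof.
move=> cn e0; apply: (@compact_uniform_cvg R X flow (value n) mu) => // x.
exact: cn.
Qed.

(** The integrand and the measure vary at once. Compactness of [X] makes the dependence of the
    integrand on the flow uniform in the state; with the integrand frozen, weak continuity of [p]
    applies. *)
Let action_value_joint n : joint_continuous n ->
  continuous (fun z : (flow * X) * A => action_value n z.1.1 z.1.2 z.2).
Proof.
move=> cn z.
pose g (z : (flow * X) * A) := (z.1.1 0%N, (z.1.2, z.2)).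
have cg1 : {for z, continuous (fun z : (flow * X) * A => z.1.1)}.
  by apply: (@continuous_comp _ _ _ fst fst); exact: fst_continuous.
have cg : {for z, continuous g}.
  apply: continuous_pair.
    apply: (@continuous_comp _ _ _ (fun z : (flow * X) * A => z.1.1)
      (fun mu : flow => mu 0%N)) => //.
    exact: eval_continuous.
  apply: continuous_pair; last exact: snd_continuous.
  by apply: (@continuous_comp _ _ _ fst snd);
    [exact: fst_continuous|exact: snd_continuous].
apply: cvgD.
  apply: (@continuous_comp _ _ _ g
    (fun z : wprobability X R * (X * A) => c z.2.1 z.2.2 z.1)) => //.
  exact: cost_continuous.
apply: cvgM; first exact: cvg_cst.
apply/cvgrPdist_lt => e e0; have e2 : 0 < e / 2 by rewrite divr_gt0.
have k1 : \forall z' \near z, forall x,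
    `|value n (shift_flow z'.1.1) x - value n (shift_flow z.1.1) x| < e / 2.
  have hs : {for z, continuous (fun z : (flow * X) * A => shift_flow z.1.1)}.
    apply: (@continuous_comp _ _ _ (fun z : (flow * X) * A => z.1.1)) => //.
    exact: shift_flow_continuous.
  exact: hs _ (value_uniform (shift_flow z.1.1) cn e2).
have cV := @value_section n (shift_flow z.1.1) cn.
have /cvgrPdist_lt/(_ _ e2) k2 := @continuous_comp _ _ _ g
  (fun z' : wprobability X R * (X * A) =>
    \int[p z'.2.1 z'.2.2 z'.1]_y value n (shift_flow z.1.1) y) z cg
  (@transition_integral_continuous _ cV _).
apply: filterS2 k1 k2 => z' k1 /= k2.
have k3 : `|\int[p z'.1.2 z'.2 (z'.1.1 0%N)]_y value n (shift_flow z'.1.1) y -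
   \int[p z'.1.2 z'.2 (z'.1.1 0%N)]_y value n (shift_flow z.1.1) y| <= e / 2.
  apply: bRintegral_dist.
  - exact/(continuous_bmeasurable compactX)/value_section.
  - exact: (continuous_bmeasurable compactX cV).
  - by move=> y; exact/ltW/k1.
move: k2 k3; rewrite ltr_distl ler_distl ltr_distl => /andP[? ?] /andP[? ?].
by apply/andP; split; lra.
Qed.

Let action_value_section n mu x : joint_continuous n ->
  continuous (action_value n mu x).
Proof.
move=> cn; exact: (@continuous_section1 _ _ _
  (fun z : (flow * X) * A => action_value n z.1.1 z.1.2 z.2) (mu, x)
  (action_value_joint cn)).
Qed.

(** An infimum is 1-Lipschitz for the uniform distance, and compactness of [A] makes the action
    values vary uniformly in the action. *)
Lemma value_continuous n : continuous (fun z : flow * X => value n z.1 z.2).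
Proof.
elim: n => [|n IH] z; first exact: cvg_cst.
apply/cvgrPdist_le => e e0.
have : \forall z' \near z, forall a,
    `|action_value n z'.1 z'.2 a - action_value n z.1 z.2 a| < e.
  apply: (@compact_uniform_cvg R A (flow * X)%type
    (fun z => action_value n z.1 z.2) z) => // a.
  exact: action_value_joint.
apply: filterS => z' h.
rewrite distrC; apply: inf_range_dist.
- exact/(continuous_has_lbound compactA)/action_value_section.
- exact/(continuous_has_lbound compactA)/action_value_section.
- by move=> a; exact/ltW/h.
Qed.

Lemma value_continuous_state n mu : continuous (value n mu).
Proof. exact/value_section/value_continuous. Qed.

Lemma value_bmeasurable n mu : bmeasurable (value n mu).
Proof. exact/(continuous_bmeasurable compactX)/value_continuous_state. Qed.

Lemma value_uniform_cvg n (mu : flow) e : 0 < e ->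
  \forall mu' \near mu, forall x, `|value n mu' x - value n mu x| < e.
Proof. exact/value_uniform/value_continuous. Qed.

Lemma action_value_continuous n mu :
  continuous (fun z : X * A => action_value n mu z.1 z.2).
Proof.
move=> [x a].
apply: (@continuous_comp _ _ _ (fun z : X * A => ((mu, z.1), z.2))
  (fun z : (flow * X) * A => action_value n z.1.1 z.1.2 z.2)).
  apply: continuous_pair; last exact: snd_continuous.
  by apply: continuous_pair; [exact: cvg_cst|exact: fst_continuous].
exact: (action_value_joint (@value_continuous n)).
Qed.

Let action_value_lbound n mu x : has_lbound (range (action_value n mu x)).
Proof.
exact/(continuous_has_lbound compactA)/action_value_section/value_continuous.
Qed.

Lemma value_le_action n mu x a : value n.+1 mu x <= action_value n mu x a.
Proof. exact: (inf_range_le a (@action_value_lbound n mu x)). Qed.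

Lemma approx_action n mu e : 0 < e ->
  exists2 s : X -> A, measurable_fun setT s &
    forall x, action_value n mu x (s x) < value n.+1 mu x + e.
Proof.
move=> e0; apply: (measurable_selector basisA) => //.
- move=> a; apply: continuous_measurable.
  exact: (continuous_section2 (@action_value_continuous n mu)).
- by have [] := value_bmeasurable n.+1 mu.
- by move=> x; exact/action_value_section/value_continuous.
- move=> x; exact: (inf_range_approx (@action_value_lbound n mu x) e0).
Qed.

End value.

(** * Expected costs *)

Section discounted_sums.
Context (R : realType).
Variables (beta M : R).
Hypothesis beta_ge0 : 0 <= beta.
Hypothesis beta_lt1 : beta < 1.

Lemma discounted_tail (u : nat -> R) N T : (forall t, `|u t| <= M) -> (N <= T)%N ->
  `|\sum_(t < T) beta ^+ t * u t - \sum_(t < N) beta ^+ t * u t|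
    <= M * beta ^+ N / (1 - beta).
Proof.
move=> uM NT; have b1 : 0 < 1 - beta by rewrite subr_gt0.
have M0 : 0 <= M by exact: le_trans (uM 0%N).
(* The exact geometric sum is kept, as the induction on [T] would not go through with the final
   bound. *)
apply: (@le_trans _ _ (M * (beta ^+ N - beta ^+ T) / (1 - beta))); last first.
  rewrite ler_pM2r ?invr_gt0// ler_wpM2l//.
  by rewrite gerBl exprn_ge0.
rewrite ler_pdivlMr//.
elim: T NT => [|T IH].
  by rewrite leqn0 => /eqP ->; rewrite !subrr normr0 mul0r mulr0.
rewrite leq_eqVlt => /predU1P[<-|]; first by rewrite !subrr normr0 mul0r mulr0.
rewrite ltnS => /IH{}IH; rewrite big_ord_recr/= addrAC.
apply: (@le_trans _ _ ((`|\sum_(t < T) beta ^+ t * u t - \sum_(t < N) beta ^+ t * u t|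
   + beta ^+ T * M) * (1 - beta))).
  rewrite ler_wpM2r ?(ltW b1)// (le_trans (ler_normD _ _))// lerD2l.
  by rewrite normrM ger0_norm ?exprn_ge0// ler_wpM2l ?exprn_ge0.
rewrite mulrDl exprS.
have -> : M * (beta ^+ N - beta * beta ^+ T) =
  M * (beta ^+ N - beta ^+ T) + beta ^+ T * M * (1 - beta) by ring.
by rewrite lerD2r.
Qed.

Lemma discounted_series (u : nat -> R) : (forall t, `|u t| <= M) ->
  cvgn (series (fun t => beta ^+ t * u t)).
Proof.
move=> uM.
have M0 : 0 <= M by exact: le_trans (uM 0%N).
apply: normed_cvg; apply: (@series_le_cvg _ _ (geometric M beta)).
- by move=> n; exact: normr_ge0.
- by move=> n /=; rewrite mulr_ge0// exprn_ge0.
- move=> n /=; rewrite normrM ger0_norm ?exprn_ge0// mulrC.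
  by rewrite ler_wpM2r ?exprn_ge0.
- by apply: is_cvg_geometric_series; rewrite ger0_norm.
Qed.

Lemma discounted_limit (u : nat -> R) N : (forall t, `|u t| <= M) ->
  `|limn (series (fun t => beta ^+ t * u t)) - \sum_(t < N) beta ^+ t * u t|
    <= M * beta ^+ N / (1 - beta).
Proof.
move=> uM; set l := limn _; set s := \sum_(t < N) _.
have h : `|series (fun t => beta ^+ t * u t) n - s| @[n --> \oo] --> `|l - s|.
  by apply: cvg_norm; apply: cvgB; [exact: discounted_series|exact: cvg_cst].
apply: (cvgr_to_le h); exists N => // n /= Nn.
by rewrite /series/= big_mkord; exact: discounted_tail.
Qed.

Lemma discounted_tail_cvg0 : M * beta ^+ N / (1 - beta) @[N --> \oo] --> 0.
Proof.
rewrite -[X in _ --> X](mul0r ((1 - beta)^-1)) -[X in X * _](mulr0 M).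
apply: cvgM; last exact: cvg_cst.
apply: cvgM; first exact: cvg_cst.
by apply: cvg_expr; rewrite ger0_norm.
Qed.

End discounted_sums.

Section process_costs.
Context (R : realType) d d' (X : borelMetricType R d) (A : borelType d').
Variable bA : nat -> set A.
Hypothesis basisA : basis_seq bA.
Hypothesis compactA : compact [set: A].
Hypothesis compactX : compact [set: X].
Variables (beta : R) (c : X -> A -> wprobability X R -> R).
Variables (p : X -> A -> wprobability X R -> wprobability X R).
Variable mu0 : probability X R.
Hypothesis beta_ge0 : 0 <= beta.
Hypothesis beta_lt1 : beta < 1.
Hypothesis continuous_cp : forall (x_ : nat -> X) (a_ : nat -> A)
        (mu_ : nat -> wprobability X R) (x : X) (a : A)
        (mu : wprobability X R),
      x_ n @[n --> \oo] --> x -> a_ n @[n --> \oo] --> a ->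
      mu_ n @[n --> \oo] --> mu ->
      (c (x_ n) (a_ n) (mu_ n) @[n --> \oo] --> c x a mu) /\
      (p (x_ n) (a_ n) (mu_ n) @[n --> \oo] --> p x a mu).

Let mp := measurable_transition_kernel basisA compactX continuous_cp.

Let V := value beta c p.
Let Q := action_value beta c p.

Variable M : R.
Hypothesis cM : forall x a mu, `|c x a mu| <= M.

Let tail N := M * beta ^+ N / (1 - beta).

Definition flow_from k (mu : nat -> wprobability X R) :
    {ptws nat -> wprobability X R} :=
  fun t => mu (t + k)%N.

Let shift_flow_from k mu : shift_flow (flow_from k mu) = flow_from k.+1 mu.
Proof. by apply/funext => t; rewrite /shift_flow /flow_from addSnnS. Qed.

Let bV n mu : bmeasurable (V n mu).
Proof. exact: (value_bmeasurable basisA compactA compactX). Qed.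

Lemma cost_section_continuous mu :
  continuous (fun z : X * A => c z.1 z.2 mu).
Proof.
exact: (continuous_section1 (cost_continuous basisA compactX continuous_cp)).
Qed.

Lemma cost_section_bmeasurable mu : bmeasurable (fun z : X * A => c z.1 z.2 mu).
Proof.
exact/(continuous_bmeasurable_prod basisA compactA compactX)/cost_section_continuous.
Qed.

Let bQ n mu : bmeasurable (fun z : X * A => Q n mu z.1 z.2).
Proof.
apply: (continuous_bmeasurable_prod basisA compactA compactX).
exact: (action_value_continuous basisA compactA compactX).
Qed.

Section one_process.
Variables (h : option nat) (pi : nat -> R.-pker X ~> A).
Variable mu : nat -> wprobability X R.
Context d0 (O : measurableType d0) (P : probability O R).
Variables (x : nat -> {RV P >-> X}) (a : nat -> {RV P >-> A}).
Hypothesis proc : controlled_process p mu0 h pi mu x a.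

Let mxa t : measurable_fun setT (fun w => (x t w, a t w)) :=
  measurable_state_action x a t.

Definition stage_cost t : R := \int[P]_w c (x t w) (a t w) (mu t).

Let bcost t : bmeasurable (fun w => c (x t w) (a t w) (mu t)).
Proof. exact: (bmeasurable_comp (mxa t) (cost_section_bmeasurable (mu t))). Qed.

Lemma stage_cost_norm t : `|stage_cost t| <= M.
Proof. by apply: bRintegral_norm => // w; exact: cM. Qed.

Let bQxa n k : bmeasurable (fun w => Q n (flow_from k mu) (x k w) (a k w)).
Proof. exact: (bmeasurable_comp (mxa k) (bQ n (flow_from k mu))). Qed.

Let bVx n m k : bmeasurable (fun w => V n (flow_from m mu) (x k w)).
Proof. exact: (bmeasurable_comp (measurable_funPT (x k)) (bV n (flow_from m mu))). Qed.

(** For [n = 0] the continuation value is zero, so nothing is asked of the transition out of the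
    last stage, which the horizon does not constrain. *)
Lemma action_value_step n k : (0 < n)%N ==> stage h k.+1 ->
  \int[P]_w Q n (flow_from k mu) (x k w) (a k w) =
  stage_cost k + beta * \int[P]_w V n (flow_from k.+1 mu) (x k.+1 w).
Proof.
move=> hn.
have [bI <-] : bmeasurable (fun w => \int[p (x k w) (a k w) (mu k)]_y
      V n (flow_from k.+1 mu) y) /\
    \int[P]_w \int[p (x k w) (a k w) (mu k)]_y V n (flow_from k.+1 mu) y =
    \int[P]_w V n (flow_from k.+1 mu) (x k.+1 w).
  case: n hn => [_|n hn].
    have E : (fun w => \int[p (x k w) (a k w) (mu k)]_y V 0 (flow_from k.+1 mu) y)
        = cst 0.
      by apply/funext => w; exact: (bRintegral_cst _ 0).
    by rewrite E; split; [exact: bmeasurable_cst|rewrite !(bRintegral_cst _ 0)].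
  have [] := transition_Rintegral mp proc hn (bV n.+1 (flow_from k.+1 mu)).
  by move=> ? ->.
rewrite -bRintegralZ// -bRintegralD//; last exact: bmeasurableZ.
by apply: eq_Rintegral => w _; rewrite /Q /action_value shift_flow_from.
Qed.

(** The value is pointwise below the action value of whatever is played; integrating this along the
    process unrolls the recursion. *)
Lemma value_le_cost n k : (forall t, (t.+1 < n)%N -> stage h (t + k).+1) ->
  \int[P]_w V n (flow_from k mu) (x k w) <=
  \sum_(t < n) beta ^+ t * stage_cost (t + k).
Proof.
elim: n k => [|n IH] k hn.
  by rewrite big_ord0 (bRintegral_cst P 0).
apply: (@le_trans _ _ (\int[P]_w Q n (flow_from k mu) (x k w) (a k w))).
  apply: le_bRintegral; [exact: bVx|exact: bQxa|move=> w].
  exact: (value_le_action basisA compactA compactX).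
rewrite big_ord_recl/= expr0 mul1r add0n.
rewrite action_value_step; last first.
  by apply/implyP => n0; apply: (hn 0%N); rewrite ltnS.
rewrite lerD2l.
apply: (@le_trans _ _ (beta * \sum_(t < n) beta ^+ t * stage_cost (t + k.+1))).
  rewrite ler_wpM2l// IH// => t tn; rewrite addnS -addSn; exact: hn.
rewrite mulr_sumr; apply: ler_sum => t _.
by rewrite /bump/= add1n mulrA -exprS addSnnS.
Qed.

(** Each stage loses at most [e] against the value, and as [beta <= 1] discounting does not enlarge
    the losses, whence [n * e]. After the action of stage k there remain [N - k.+1] stages, which is
    why [s k] is compared with that action value. *)
Lemma cost_le_value N e (s : forall k, X -> A)
    (ms : forall k, measurable_fun setT (s k)) :
  (forall k, (k < N)%N -> stage h k) ->
  (forall k, pi k = kdirac (ms k)) ->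
  (forall k y, Q (N - k.+1) (flow_from k mu) y (s k y) <
    V (N - k.+1).+1 (flow_from k mu) y + e) ->
  forall n k, (n + k)%N = N ->
  \sum_(t < n) beta ^+ t * stage_cost (t + k) <=
  \int[P]_w V n (flow_from k mu) (x k w) + n%:R * e.
Proof.
move=> hN piE sQ; elim=> [|n IH] k nk.
  by rewrite big_ord0 (bRintegral_cst P 0) mul0r addr0.
have kN : (k < N)%N by rewrite -nk addSn ltnS leq_addl.
have nE : (N - k.+1)%N = n by rewrite -nk addSnnS addnK.
have sQk := sQ k; rewrite nE in sQk.
(* The sign of [e] follows from the hypothesis on [s], as no action beats the value. *)
have e0 : 0 <= e.
  have := sQk point.
  have :  V n.+1 (flow_from k mu) point <= Q n (flow_from k mu) point (s k point).
    exact: (value_le_action basisA compactA compactX).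
  lra.
have {}IH := IH k.+1; rewrite addnS -addSn in IH; have {}IH := IH nk.
set W := \int[P]_w V n.+1 (flow_from k mu) (x k w).
rewrite big_ord_recl/= expr0 mul1r add0n.
have -> : \sum_(i < n) beta ^+ bump 0 i * stage_cost (bump 0 i + k) =
    beta * \sum_(t < n) beta ^+ t * stage_cost (t + k.+1).
  rewrite mulr_sumr; apply: eq_bigr => t _.
  by rewrite /bump/= add1n mulrA -exprS addSnnS.
apply: (@le_trans _ _ (stage_cost k +
    beta * \int[P]_w V n (flow_from k.+1 mu) (x k.+1 w) + n%:R * e)).
  rewrite -addrA lerD2l.
  apply: le_trans (ler_wpM2l beta_ge0 IH) _.
  by rewrite mulrDr lerD2l ler_piMl ?mulr_ge0// ltW.
rewrite -action_value_step; last first.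
  by apply/implyP => n0; apply: hN; rewrite -nk addSn ltnS -addn1 addnC leq_add2r.
rewrite -natr1 mulrDl mul1r addrA [leRHS]addrAC lerD2r.
rewrite (action_Rintegral proc (hN _ kN) (bQ n (flow_from k mu))).
rewrite -[X in _ + X](bRintegral_cst P) /W.
rewrite -(bRintegralD P (bVx n.+1 k k) (bmeasurable_cst _ e)).
have E w : \int[kernel_law (pi k) (x k w)]_b Q n (flow_from k mu) (x k w) b =
    Q n (flow_from k mu) (x k w) (s k (x k w)).
  have bq : bmeasurable (fun b => Q n (flow_from k mu) (x k w) b).
    exact: (bmeasurable_comp (pair1_measurable (x k w)) (bQ n (flow_from k mu))).
  rewrite /Rintegral integral_kernel_law piE /kdirac integral_dirac//.
    by rewrite diracT mul1e.
  by apply/measurable_EFinP; have [] := bq.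
under eq_Rintegral do rewrite E.
apply: le_bRintegral.
- have ms' : measurable_fun setT (fun w => (x k w, s k (x k w))).
    apply: measurable_fun_pair => //.
    exact: measurableT_comp.
  exact: (bmeasurable_comp ms' (bQ n (flow_from k mu))).
- by apply: bmeasurableD; [exact: bVx|exact: bmeasurable_cst].
- by move=> w; exact/ltW/sQk.
Qed.

Lemma value_initial n : \int[P]_w V n mu (x 0%N w) = \int[mu0]_y V n mu y.
Proof.
apply: (Rintegral_law _ (fun B mB => initial_law proc mB) (bV n mu)).
exact: measurable_funPT.
Qed.

Let bdiscounted T :
  bmeasurable (fun w => \sum_(t < T) beta ^+ t * c (x t w) (a t w) (mu t)).
Proof.
apply: (@bmeasurable_sum _ _ _ T (fun t w => beta ^+ t * c (x t w) (a t w) (mu t))).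
by move=> t; exact: bmeasurableZ.
Qed.

Let Rintegral_discounted T :
  \int[P]_w (\sum_(t < T) beta ^+ t * c (x t w) (a t w) (mu t)) =
  \sum_(t < T) beta ^+ t * stage_cost t.
Proof.
rewrite (@bRintegral_sum _ _ _ P T
  (fun t w => beta ^+ t * c (x t w) (a t w) (mu t))); last first.
  by move=> t; exact: bmeasurableZ.
by apply: eq_bigr => t _; rewrite bRintegralZ.
Qed.

Lemma expected_cost_finite T :
  expected_cost beta c (Some T) mu x a =
  (\sum_(t < T) beta ^+ t * stage_cost t)%:E.
Proof. by rewrite /expected_cost unlock -Rintegral_discounted EFin_Rintegral. Qed.

(** The truncation error is bounded uniformly over the paths, hence survives integration; the random
    total cost is measurable as a limit of partial sums. *)
Lemma expected_cost_infinite : exists r,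
  expected_cost beta c None mu x a = r%:E /\
  forall N, `|r - \sum_(t < N) beta ^+ t * stage_cost t| <= tail N.
Proof.
pose u w t := c (x t w) (a t w) (mu t).
pose f w := limn (series (fun t => beta ^+ t * u w t)).
have uM w t : `|u w t| <= M by exact: cM.
have fN w N : `|f w - \sum_(t < N) beta ^+ t * u w t| <= tail N.
  exact: discounted_limit.
have bf : bmeasurable f.
  apply: (@bmeasurableW _ _ _ _ (tail 0)).
    apply: (@measurable_fun_cvg _ _ _ _ (fun n w => \sum_(t < n) beta ^+ t * u w t)).
      by move=> n; have [] := bdiscounted n.
    move=> w _.
    have -> : (fun n => \sum_(t < n) beta ^+ t * u w t) =
        series (fun t => beta ^+ t * u w t).
      by apply/funext => n; rewrite /series/= big_mkord.
    exact: discounted_series.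
  by move=> w; have := fN w 0%N; rewrite big_ord0 subr0.
exists (\int[P]_w f w); split.
  by rewrite /expected_cost unlock -EFin_Rintegral.
move=> N; rewrite -Rintegral_discounted.
apply: bRintegral_dist; [exact: bf|exact: bdiscounted|].
by move=> w; exact: fN.
Qed.

End one_process.

End process_costs.

(** * Passage to the limit *)

(** Replaces the extraction of a subsequence, without any countability assumption on [T]: the sets
    of large n with [u n] in a given neighbourhood of [l] generate the filter. *)
Lemma cluster_subfilter (T : topologicalType) (u : nat -> T) (l : T) :
  cluster (u @ \oo) l ->
  exists F : set_system nat, [/\ ProperFilter F, F --> \oo & u @ F --> l].
Proof.
move=> ul.
exists (filter_from [set UN : set T * nat | nbhs l UN.1]
  (fun UN => [set n | (UN.2 <= n)%N /\ UN.1 (u n)])); split.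
- apply: filter_from_proper; last first.
    move=> [U N] /= nU.
    have /(ul _ _) /(_ nU)[_ [[n Nn <-] Uun]] : (u @ \oo) (u @` [set n | (N <= n)%N]).
      by exists N => // n /= Nn; exists n.
    by exists n.
  apply: filter_from_filter; first by exists (setT, 0%N) => /=; exact: filterT.
  move=> [U N] [V K] /= nU nV; exists (U `&` V, maxn N K); first exact: filterI.
  by move=> n /= [+ [Un Vn]]; rewrite geq_max => /andP[? ?].
- move=> S [N _ NS]; exists (setT, N); first exact: filterT.
  by move=> n [/= Nn _]; exact: NS.
- by move=> S nS; exists (S, 0%N) => // n [].
Qed.

Section equilibrium.
Context (R : realType) d d' (X : borelMetricType R d) (A : borelType d').
Variable bA : nat -> set A.
Hypothesis basisA : basis_seq bA.
Hypothesis compactA : compact [set: A].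
Hypothesis compactX : compact [set: X].
Variables (beta : R) (c : X -> A -> wprobability X R -> R).
Variables (p : X -> A -> wprobability X R -> wprobability X R).
Variable mu0 : probability X R.
Hypothesis beta_ge0 : 0 <= beta.
Hypothesis beta_lt1 : beta < 1.
Hypothesis continuous_cp : forall (x_ : nat -> X) (a_ : nat -> A)
        (mu_ : nat -> wprobability X R) (x : X) (a : A)
        (mu : wprobability X R),
      x_ n @[n --> \oo] --> x -> a_ n @[n --> \oo] --> a ->
      mu_ n @[n --> \oo] --> mu ->
      (c (x_ n) (a_ n) (mu_ n) @[n --> \oo] --> c x a mu) /\
      (p (x_ n) (a_ n) (mu_ n) @[n --> \oo] --> p x a mu).

Let mp := measurable_transition_kernel basisA compactX continuous_cp.
Let V := value beta c p.

Variable M : R.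
Hypothesis cM : forall x a mu, `|c x a mu| <= M.

Let tail N := M * beta ^+ N / (1 - beta).

Let bc mu : bmeasurable (fun z : X * A => c z.1 z.2 mu).
Proof. exact: (cost_section_bmeasurable basisA compactA compactX continuous_cp). Qed.

(** One [tail N] pays for dropping the stages from N on in the cost of the equilibrium, the other
    for dropping them in the cost of the competitor. *)
Lemma finite_horizon_bound T N pi mu : (N <= T)%N ->
  mean_field_equilibrium beta c p mu0 (Some T) pi mu ->
  \sum_(t < N) beta ^+ t * \int[joint_law (pi t) (mu t)]_z c z.1 z.2 (mu t) <=
  \int[mu0]_x V N mu x + 2 * tail N.
Proof.
move=> NT [init opt flow].
have [d1 [] O1 [] P1 [] x1 [] a1 proc1] := exists_process mp mu0 pi mu T.
apply/ler_addgt0Pr => e' e'0.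
(* The N stages lose at most [N * e <= e']; the successor avoids dividing by zero when [N = 0]. *)
pose e := e' / N.+1%:R.
have e0 : 0 < e by rewrite divr_gt0.
(* For [k >= N] truncated subtraction leaves 0 stages to go and the choice is myopic; costs from
   there on are absorbed by the tail. *)
have hsel k : exists s : X -> A, measurable_fun setT s /\ forall y,
    action_value beta c p (N - k.+1) (flow_from k mu) y (s y) <
    V (N - k.+1).+1 (flow_from k mu) y + e.
  have [s ms hs] := approx_action basisA compactA compactX beta continuous_cp
    (N - k.+1) (flow_from k mu) e0.
  by exists s.
have [s hs] := choice hsel.
pose ms k := (hs k).1.
have [d2 [] O2 [] P2 [] x2 [] a2 proc2] :=
  exists_process mp mu0 (fun k => kdirac (ms k) : R.-pker X ~> A) mu T.
have := opt _ _ _ _ _ _ _ _ _ _ _ proc1 proc2.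
rewrite !(expected_cost_finite basisA compactA compactX beta continuous_cp) lee_fin.
set S1 := \sum_(t < T) _; set S2 := \sum_(t < T) _ => S12.
have S1N := discounted_tail beta_ge0 beta_lt1
  (stage_cost_norm basisA compactA compactX continuous_cp cM mu x1 a1) NT.
have S2N := discounted_tail beta_ge0 beta_lt1
  (stage_cost_norm basisA compactA compactX continuous_cp cM mu x2 a2) NT.
have SE : \sum_(t < N) beta ^+ t * \int[joint_law (pi t) (mu t)]_z c z.1 z.2 (mu t)
    = \sum_(t < N) beta ^+ t * stage_cost c mu x1 a1 t.
  apply: eq_bigr => t _; congr (_ * _); apply/esym.
  apply: (state_action_Rintegral mp proc1 init flow _ (bc (mu t))).
  by rewrite /= (leq_trans _ NT).
have H : \sum_(t < N) beta ^+ t * stage_cost c mu x2 a2 (t + 0) <=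
    \int[P2]_w V N (flow_from 0 mu) (x2 0%N w) + N%:R * e.
  apply: (cost_le_value basisA compactA compactX beta_ge0 beta_lt1 continuous_cp
    proc2 (s := s) (ms := ms)) (addn0 N) => //.
    by move=> k kN /=; exact: leq_trans kN NT.
  by move=> k y; exact: (hs k).2.
have flow_from0 : flow_from 0 mu = mu by apply/funext => t; rewrite /flow_from addn0.
rewrite flow_from0
  (value_initial basisA compactA compactX beta continuous_cp proc2) in H.
have E0 : \sum_(t < N) beta ^+ t * stage_cost c mu x2 a2 (t + 0) =
    \sum_(t < N) beta ^+ t * stage_cost c mu x2 a2 t.
  by apply: eq_bigr => t _; rewrite addn0.
rewrite E0 in H.
have Ne : N%:R * e <= e'.
  rewrite /e mulrCA ler_piMr ?(ltW e'0)// ler_pdivrMr// mul1r ler_nat.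
  exact: leqnSn.
rewrite SE -/V in H *.
move: S1N S2N; rewrite -/S1 -/S2 -/(tail N) !ler_norml => /andP[? ?] /andP[? ?].
lra.
Qed.

Section limit.
Variables (F : set_system nat).
Context {FF : ProperFilter F}.
Hypothesis Foo : F --> \oo.
Variables (piT : nat -> nat -> R.-pker X ~> A) (muT : nat -> nat -> wprobability X R).
Hypothesis mfeT : forall T, (1 <= T)%N ->
  mean_field_equilibrium beta c p mu0 (Some T) (piT T) (muT T).
Variables (nu : nat -> wprobability (X * A)%type R).
Hypothesis nuT_cvg : forall t,
  (joint_law (piT T t) (muT T t) : wprobability (X * A)%type R) @[T --> F] --> nu t.
Variables (pi : nat -> R.-pker X ~> A) (mu : nat -> wprobability X R).
Hypothesis marginal : forall t B, measurable B -> mu t B = nu t (fst @^-1` B).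
Hypothesis disintegration : forall t B, measurable B ->
  nu t B = joint_law (pi t) (mu t) B.

Let near_ge N : \forall T \near F, (N <= T)%N.
Proof. by apply: Foo; exact: nbhs_infty_ge. Qed.

Let prod_weak_cvg t (f : X * A -> R) : continuous f ->
  \int[joint_law (piT T t) (muT T t)]_z f z @[T --> F] --> \int[nu t]_z f z.
Proof.
move=> cf.
have [_ bf] := continuous_bmeasurable_prod basisA compactA compactX cf.
have := iffLR (weak_cvgP _ _) (@nuT_cvg t) f cf.
by apply; exact/bounded_fun_normP.
Qed.

Let nu_Rintegral t (f : X * A -> R) : bmeasurable f ->
  \int[nu t]_z f z = \int[joint_law (pi t) (mu t)]_z f z.
Proof.
move=> bf.
apply: (@Rintegral_law _ _ _ _ _ (nu t) (joint_law (pi t) (mu t)) idfun _ _ f bf).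
- exact: measurable_id.
- by move=> B mB; exact: disintegration.
Qed.

(** A test function of the state alone is also a test function on pairs. *)
Let muT_cvg t : muT T t @[T --> F] --> mu t.
Proof.
apply/(weak_cvg_compactP compactX) => f cf.
have cf1 : continuous (fun z : X * A => f z.1).
  move=> z; apply: (@continuous_comp _ _ _ fst f); last exact: cf.
  exact: fst_continuous.
have bf := continuous_bmeasurable compactX cf.
have := @prod_weak_cvg t _ cf1.
have -> : \int[nu t]_z f z.1 = \int[mu t]_x f x.
  apply: (Rintegral_law _ _ bf); first exact: measurable_fst.
  by move=> B mB; rewrite marginal.
suff -> : (fun T => \int[joint_law (piT T t) (muT T t)]_z f z.1) =
    (fun T => \int[muT T t]_x f x) by [].
apply/funext => T; apply: (Rintegral_law _ _ bf); first exact: measurable_fst.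
by move=> B mB; exact: joint_law_fst.
Qed.

Let muT_Rintegral_cvg t (f : X -> R) : continuous f ->
  \int[muT T t]_x f x @[T --> F] --> \int[mu t]_x f x.
Proof.
move=> cf.
exact: cvg_comp (@muT_cvg t) (@Rintegral_continuous _ _ _ f compactX cf (mu t)).
Qed.

(** Since [X * A] is compact, [g] at the approximating measure converges uniformly to [g] at the
    limit, which leaves weak convergence against a fixed integrand. It serves both for the stage
    costs and for the flow equation. *)
Let joint_cvg t (g : wprobability X R -> X * A -> R) :
  continuous (fun z : wprobability X R * (X * A) => g z.1 z.2) ->
  \int[joint_law (piT T t) (muT T t)]_z g (muT T t) z @[T --> F] -->
  \int[joint_law (pi t) (mu t)]_z g (mu t) z.
Proof.
move=> cg; have cgs m : continuous (g m) := continuous_section1 cg.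
have bg m := continuous_bmeasurable_prod basisA compactA compactX (cgs m).
rewrite -nu_Rintegral//.
apply/cvgrPdist_lt => e e0; have e2 : 0 < e / 2 by rewrite divr_gt0.
have cXA : compact [set: X * A] by rewrite -setXTT; exact: compact_setX.
have h1 : \forall T \near F, forall z, `|g (muT T t) z - g (mu t) z| < e / 2.
  have h := @compact_uniform_cvg R (X * A)%type (wprobability X R) g (mu t) cXA
    (fun z => cg (mu t, z)) _ e2.
  exact: (@muT_cvg t) _ h.
have /cvgrPdist_lt/(_ _ e2) h2 := @prod_weak_cvg t _ (cgs (mu t)).
apply: filterS2 h1 h2 => T h1 h2.
have h3 : `|\int[joint_law (piT T t) (muT T t)]_z g (muT T t) z -
    \int[joint_law (piT T t) (muT T t)]_z g (mu t) z| <= e / 2.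
  by apply: bRintegral_dist => // z; exact/ltW.
rewrite (splitr e).
apply: le_lt_trans
  (ler_distD (\int[joint_law (piT T t) (muT T t)]_z g (mu t) z) _ _) _.
by apply: ltr_leD => //; rewrite distrC.
Qed.

Lemma limit_initial B : measurable B -> mu 0%N B = mu0 B.
Proof.
apply: (@continuous_Rintegral_unique _ _ _ (mu 0%N) mu0) => f cf.
have bf := continuous_bmeasurable compactX cf.
have h := @muT_Rintegral_cvg 0 f cf.
have h' : \int[muT T 0%N]_x f x @[T --> F] --> \int[mu0]_x f x.
  apply: cvg_near_cst; apply: filterS (near_ge 1) => T T1.
  apply: (@Rintegral_law _ _ _ _ _ (muT T 0%N) mu0 idfun _ _ f bf).
    exact: measurable_id.
  exact: mfe_initial (mfeT T1).
by rewrite -(cvg_lim _ h)// (cvg_lim _ h').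
Qed.

(** The right-hand side of the flow equation, realized as a marginal of a joint law in order to be a
    probability to which uniqueness by test functions applies. *)
Let next_law m (J : probability (X * A)%type R) : probability X R :=
  distribution (joint_law (kernel_of (mp m)) J)
    (mfun_of (@measurable_snd _ _ (X * A)%type X)).

Let next_lawE m (J : probability (X * A)%type R) B : measurable B ->
  next_law m J B = (\int[J]_z p z.1 z.2 m B)%E.
Proof.
move=> mB.
rewrite -[LHS]/(joint_law (kernel_of (mp m)) J (snd @^-1` B)).
by rewrite -[_ @^-1` _]setTI -(preimage_setT fst) joint_law_setX.
Qed.

Let next_law_Rintegral m (J : probability (X * A)%type R) (f : X -> R) :
  bmeasurable f ->
  \int[next_law m J]_y f y = \int[J]_z \int[p z.1 z.2 m]_y f y.
Proof.
move=> bf.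
have [_ ->//] := @mixture_Rintegral R _ _ _ _ X (X * A)%type X X (next_law m J) J
  idfun (fun z => p z.1 z.2 m) (fun _ y => y) (@measurable_id _ _ _)
  (fun _ => @measurable_id _ _ _)
  (fun B mB => conj (mp m mB) (next_lawE m J mB)) f bf.
Qed.

Lemma limit_flow t B : measurable B ->
  mu t.+1 B = (\int[mu t]_x \int[pi t x]_a p x a (mu t) B)%E.
Proof.
move=> mB; rewrite -(joint_law_transition mp)// -next_lawE//.
move: B mB; apply: (@continuous_Rintegral_unique _ _ _ (mu t.+1)) => f cf.
have bf := continuous_bmeasurable compactX cf.
have h := @muT_Rintegral_cvg t.+1 f cf.
have h' : \int[muT T t.+1]_x f x @[T --> F] -->
    \int[next_law (mu t) (joint_law (pi t) (mu t))]_x f x.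
  rewrite next_law_Rintegral//.
  have := @joint_cvg t (fun m z => \int[p z.1 z.2 m]_y f y)
    (transition_integral_continuous basisA compactX continuous_cp cf).
  apply: cvg_trans; apply: near_eq_cvg.
  (* Stage [t.+1] must lie within the horizon for the flow equation of the T-horizon game to hold at
     [t]. *)
  apply: filterS (near_ge t.+2) => T tT.
  rewrite -next_law_Rintegral//; apply/esym.
  apply: (@Rintegral_law _ _ _ _ _ (muT T t.+1) (next_law (muT T t) _) idfun _ _ f bf).
    exact: measurable_id.
  move=> B mB; rewrite next_lawE// (joint_law_transition mp)//.
  have T1 : (1 <= T)%N by exact: leq_trans tT.
  exact: (mfe_flow (mfeT T1)).
by rewrite -(cvg_lim _ h)// (cvg_lim _ h').
Qed.

Lemma limit_bound N :
  \sum_(t < N) beta ^+ t * \int[joint_law (pi t) (mu t)]_z c z.1 z.2 (mu t) <=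
  \int[mu0]_x V N mu x + 2 * tail N.
Proof.
pose S n (pi : nat -> R.-pker X ~> A) (mu : nat -> wprobability X R) :=
  \sum_(t < n) beta ^+ t * \int[joint_law (pi t) (mu t)]_z c z.1 z.2 (mu t).
have hS n : S n (piT T) (muT T) @[T --> F] --> S n pi mu.
  rewrite /S; elim: n => [|n IH].
    by rewrite big_ord0; under eq_fun do rewrite big_ord0; exact: cvg_cst.
  rewrite big_ord_recr/=; under eq_fun do rewrite big_ord_recr/=.
  apply: cvgD => //; apply: cvgM; first exact: cvg_cst.
  apply: (@joint_cvg n (fun m z => c z.1 z.2 m)).
  exact: (cost_continuous basisA compactX continuous_cp).
have hV : \int[mu0]_x V N (muT T) x @[T --> F] --> \int[mu0]_x V N mu x.
  have bV m : bmeasurable (V N m).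
    exact: (value_bmeasurable basisA compactA compactX beta continuous_cp).
  have flow_cvg : (muT T : {ptws nat -> wprobability X R}) @[T --> F] -->
      (mu : {ptws nat -> wprobability X R}).
    by apply/prod_topology_cvgP => t; exact: muT_cvg.
  apply/cvgrPdist_le => e e0.
  have h : \forall T \near F, forall x, `|V N (muT T) x - V N mu x| < e.
    exact: flow_cvg _ (value_uniform_cvg basisA compactA compactX beta
      continuous_cp N mu e0).
  apply: filterS h => T h; apply: bRintegral_dist => // x.
  by rewrite distrC; exact/ltW/h.
rewrite -subr_le0 -/(S N pi mu).
have h : S N (piT T) (muT T) - (\int[mu0]_x V N (muT T) x + 2 * tail N) @[T --> F]
    --> S N pi mu - (\int[mu0]_x V N mu x + 2 * tail N).
  by apply: cvgB => //; apply: cvgD => //; exact: cvg_cst.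
apply: (cvgr_to_le h); apply: filterS (near_ge (maxn N 1)) => T.
rewrite geq_max => /andP[NT T1].
by rewrite subr_le0; apply: finite_horizon_bound NT _; exact: mfeT.
Qed.

Lemma limit_equilibrium : mean_field_equilibrium beta c p mu0 None pi mu.
Proof.
have init B : measurable B -> mu 0%N B = mu0 B by exact: limit_initial.
have flow t : stage None t.+1 -> forall B, measurable B ->
    mu t.+1 B = (\int[mu t]_x \int[pi t x]_a p x a (mu t) B)%E.
  by move=> _ B; exact: limit_flow.
split=> // pi' d1 O1 P1 x1 a1 d2 O2 P2 x2 a2 proc1 proc2.
have [r1 [-> h1]] := expected_cost_infinite basisA compactA compactX beta_ge0
  beta_lt1 continuous_cp cM mu x1 a1.
have [r2 [-> h2]] := expected_cost_infinite basisA compactA compactX beta_ge0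
  beta_lt1 continuous_cp cM mu x2 a2.
rewrite lee_fin -subr_le0.
(* Two tails come from [limit_bound], and one from truncating each of the two infinite costs. *)
have h : 4 * tail N @[N --> \oo] --> (4 * 0 : R).
  by apply: cvgM; [exact: cvg_cst|exact: discounted_tail_cvg0].
rewrite -[leRHS](mulr0 4); apply: (cvgr_to_ge h); apply: nearW => N.
have SE : \sum_(t < N) beta ^+ t * stage_cost c mu x1 a1 t =
    \sum_(t < N) beta ^+ t * \int[joint_law (pi t) (mu t)]_z c z.1 z.2 (mu t).
  apply: eq_bigr => t _; congr (_ * _).
  exact: (state_action_Rintegral mp proc1 init flow _ (bc (mu t))).
have B1 := limit_bound N.
have B2 : \int[P2]_w V N (flow_from 0 mu) (x2 0%N w) <=
    \sum_(t < N) beta ^+ t * stage_cost c mu x2 a2 (t + 0).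
  exact: (value_le_cost basisA compactA compactX beta_ge0 continuous_cp proc2).
have flow_from0 : flow_from 0 mu = mu by apply/funext => t; rewrite /flow_from addn0.
rewrite flow_from0
  (value_initial basisA compactA compactX beta continuous_cp proc2) in B2.
have E0 : \sum_(t < N) beta ^+ t * stage_cost c mu x2 a2 (t + 0) =
    \sum_(t < N) beta ^+ t * stage_cost c mu x2 a2 t.
  by apply: eq_bigr => t _; rewrite addn0.
rewrite E0 in B2.
have := h1 N; have := h2 N; rewrite SE -/V -/(tail N) in B1 B2 *.
rewrite !ler_norml => /andP[? ?] /andP[? ?].
lra.
Qed.

End limit.

End equilibrium.

(** * Topology of the action space *)

Section borel_subspace_topology.
Context (R : realType) (m : nat) (A : set 'rV[R]_m) (A0 : A !=set0).

Lemma borel_subspace_compact : compact A -> compact [set: borel_subspace A0].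
Proof.
move=> cA F FF _.
have FA : ((fun a : borel_subspace A0 => set_val a) @ F) A.
  by apply: (@filterS _ F _ setT); [move=> a _; exact: set_valP|exact: filterT].
have [x [Ax Fx]] := cA _ _ FA.
exists (exist _ x (mem_set Ax) : borel_subspace A0); split => //.
move=> B C FB nC.
have [_ [[D oD <-] /= Dx DC]] := nC.
have [||_ [[b Bb <-] Db]] := Fx (set_val @` B) D.
- exact: (filterS (fun (b : borel_subspace A0) (Bb : B b) => imageP set_val Bb) FB).
- exact: open_nbhs_nbhs.
- by exists b; split => //; exact: DC.
Qed.

Lemma borel_subspace_second_countable : compact A ->
  @second_countable (borel_subspace A0).
Proof.
move=> cA.
(* The topology was copied from [set_type A], so the pseudometric of the latter can be joined to the
   chosen point of the subspace. *)
pose T : pseudoPMetricType R := HB.pack (borel_subspace A0)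
  (PseudoMetric.class (set_type A)) (Pointed.class (borel_subspace A0)).
exact: (@compact_second_countable R T (borel_subspace_compact cA)).
Qed.

End borel_subspace_topology.

Theorem theorem7 (R : realType) (d : measure_display) (X : borelMetricType R d)
    (m : nat) (A : set 'rV[R]_m) (A0 : A !=set0)
    (beta L K : R) (c : X -> borel_subspace A0 -> wprobability X R -> R)
    (p : X -> borel_subspace A0 -> wprobability X R -> wprobability X R)
    (mu0 : probability X R)
    (compactX : compact [set: X]) (compactA : compact A)
    (convexA : convex_set (A : set (convex_lmodType 'rV[R]_m)))
    (beta_ge0 : 0 <= beta) (beta_lt1 : beta < 1)
    (continuous_cp : forall (x_ : nat -> X) (a_ : nat -> borel_subspace A0)
        (mu_ : nat -> wprobability X R) (x : X) (a : borel_subspace A0)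
        (mu : wprobability X R),
      x_ n @[n --> \oo] --> x -> a_ n @[n --> \oo] --> a ->
      mu_ n @[n --> \oo] --> mu ->
      (c (x_ n) (a_ n) (mu_ n) @[n --> \oo] --> c x a mu) /\
      (p (x_ n) (a_ n) (mu_ n) @[n --> \oo] --> p x a mu))
    (lipschitz_c : forall (x x' : X) (a : borel_subspace A0) (mu : wprobability X R),
      `|c x a mu - c x' a mu| <= L * mdist x x')
    (lipschitz_p : forall (x x' : X) (a : borel_subspace A0) (mu : wprobability X R),
      (wasserstein1 (p x a mu) (p x' a mu) <= (K * mdist x x')%:E)%E)
    (betaK_lt1 : beta * K < 1)
    (piT : nat -> nat -> R.-pker X ~> borel_subspace A0) (muT : nat -> nat -> wprobability X R)
    (mfeT : forall T : nat, (1 <= T)%N ->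
      mean_field_equilibrium beta c p mu0 (Some T) (piT T) (muT T))
    (nu : {ptws nat -> wprobability (X * borel_subspace A0)%type R})
    (accumulation_nu : cluster
      (joint_flow (extended_flow T (piT T)) (extended_flow T (muT T))
        @[T --> \oo]) nu)
    (pi : nat -> R.-pker X ~> borel_subspace A0) (mu : nat -> wprobability X R)
    (marginal : forall (t : nat) (B : set X),
      measurable B -> mu t B = nu t (fst @^-1` B))
    (disintegration : forall (t : nat) (B : set (X * borel_subspace A0)),
      measurable B -> nu t B = joint_law (pi t) (mu t) B) :
  mean_field_equilibrium beta c p mu0 None pi mu.
Proof.
have cA : compact [set: borel_subspace A0] := borel_subspace_compact compactA.
have [bA basisA] := second_countable_seq (borel_subspace_second_countable A0 compactA).
have [M cM] := cost_bounded basisA cA compactX continuous_cp.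
have [F [FF Foo Fnu]] := cluster_subfilter accumulation_nu.
apply: (limit_equilibrium basisA cA compactX beta_ge0 beta_lt1 continuous_cp cM
  Foo mfeT (nu := nu)) => // t.
have := iffLR (prod_topology_cvgP nu (fmap_filter _ FF)) Fnu t.
apply: cvg_trans; apply: near_eq_cvg.
(* Once [t < T] the extended flow agrees at [t] with the original one, so each coordinate of the
   limit ignores the extension. *)
have tF : \forall T \near F, (t < T)%N by apply: Foo; exact: nbhs_infty_gt.
by apply: filterS tF => T tT; rewrite /joint_flow /extended_flow tT.
Qed.
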